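(* For every finite point set $P \subset \mathbb{R}^2$ with $|P|\ge 2$, \[ |\Lambda(P)| \gtrsim |P|^{\frac{2}{3}+\frac{1}{3057}} . \]
   Context: For a finite set $P\subset\mathbb{R}^2$, $\Lambda(P):=\{p\cdot q : p,q\in P\}$, where $p\cdot q=p_1q_1+p_2q_2$ is the usual dot product. Notation: $X\gtrsim Y$ means that there are absolute constants $C,c>0$ (independent of all sets and parameters) such that $X\ge C\,Y/(\log_2 Y)^c$. *)

(* Defs.v *)
From mathcomp Require Import all_boot all_order all_algebra.
From mathcomp Require Import finmap reals exp.

Set Implicit Arguments.
Unset Strict Implicit.
Unset Printing Implicit Defensive.

Import Order.TTheory GRing.Theory Num.Theory.
Local Open Scope ring_scope.

Definition dot (R : realType) (p q : 'rV[R]_2) : R :=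
  p 0 0 * q 0 0 + p 0 1 * q 0 1.

Definition Lambda (R : realType) (P : {fset 'rV[R]_2}) : {fset R} :=
  [fset dot p q | p in P, q in P]%fset.

Definition log2 (R : realType) (x : R) : R := ln x / ln 2.

(* The asymptotic relation X >~ Y between quantities X i, Y i attached to the
   objects i satisfying D: the constants C and c are chosen before i.
   Since powR is only meaningful for a positive base, this is intended for
   families with Y i > 1 on D, so that log2 (Y i) > 0. *)
Definition gtrsim (R : realType) (I : Type) (D : I -> Prop) (X Y : I -> R)
    : Prop :=
  exists C c : R, 0 < C /\ 0 < c /\
    forall i : I, D i -> C * Y i / (log2 (Y i) `^ c) <= X i.

(* Main.v *)
Require Import Defs.
From mathcomp Require Import all_boot all_order all_algebra.
From mathcomp Require Import finmap reals exp.
From mathcomp Require Import boolp sequences zify ring lra.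

(** Rotating by quarter turns, at least N/8 of the points lie in a half-open
    quadrant; write them as a(1,m), with dot products a a' (1 + m m').  A dyadic
    pigeonhole gives M slopes with t points each, Mt >~ N.  Let u be the number
    of dot products.

    Each point has at most u dot products with a representative of each slope,
    so Szemeredi--Trotter for M parallel classes of at most u lines gives
    M^2 t <~ u^2.  It is proved by the crossing lemma.

    In logarithms, A_i + A_j + g_ij lies in a set of size u, where A_i is the
    fibre over m_i, |A_i| = t, and g_ij = ln (1 + m_i m_j).  With K = u/t,
    Cauchy--Schwarz, a packing argument and Pluennecke's inequality provide
    M/(2K) slopes for which, up to terms s_i + s_j, all g_ij lie in one set G
    with |4G - 4G| <= (2 K^7)^8 t.

    On the other hand, for n + 1 increasing slopes the mixed differences
      d_kl = g_(k+1,l+1) + g_kl - g_(k+1,l) - g_(k,l+1)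
    are positive, and the points
      p_ij = g_(i,n) - g_ij + g_(i+1,j) - g_(i+1,0)
    form a lexicographically increasing chain with steps d_ij.  The numbers
    p_ij + d_kl with d_kl <= d_ij, which lie in a translate of 4G - 4G, therefore
    coincide only if (i,j) and the value d_kl do.  The equation d_kl = v says
    that a Moebius map determined by (m_k, m_(k+1)) sends m_l to m_(l+1); two
    such maps agree at most twice, so a value v is taken O(n^(3/2)) times.
    Hence |4G - 4G| >> n^(5/2).

    Combining, (Mt)^225 << u^337, and 225/337 > 2/3 + 1/3057. *)

Set Implicit Arguments.
Unset Strict Implicit.
Unset Printing Implicit Defensive.

Import Order.TTheory GRing.Theory Num.Theory.
Local Open Scope fset_scope.
Local Open Scope ring_scope.

(** Any choice of partners along [Rl] is injective on [A]. With a relation in place of a map, the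
    partners need not be given by an explicit function. *)
Lemma fset_leq_card_rel (T U : choiceType) (A : {fset T}) (B : {fset U})
    (Rl : T -> U -> Prop) :
  (forall x, x \in A -> exists2 y, y \in B & Rl x y) ->
  (forall x x' y, x \in A -> x' \in A -> Rl x y -> Rl x' y -> x = x') ->
  (#|` A| <= #|` B|)%N.
Proof.
move=> AB Rinj; case: (fset_0Vmem A) => [->|[x0 x0A]]; first by rewrite cardfs0.
have [y0 _ _] := AB _ x0A.
have /choice[f fP] : forall x, exists y, x \in A -> y \in B /\ Rl x y.
  move=> x; case: (boolP (x \in A)) => [/AB[y yB xy]|_]; last by exists y0.
  by exists y.
have <- : #|` f @` A| = #|` A|.
  rewrite card_in_imfset //= => x x' xA x'A E.
  have [_ H] := fP _ xA; have [_ H'] := fP _ x'A.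
  by apply: (Rinj x x' (f x)) => //; rewrite E.
apply: fsubset_leq_card; apply/fsubsetP => _ /imfsetP[x /= xA ->].
by have [] := fP _ xA.
Qed.

Lemma card_fsetM (T U : choiceType) (A : {fset T}) (B : {fset U}) :
  #|` A `*` B| = (#|` A| * #|` B|)%N.
Proof.
apply: (etrans (card_fset_sum1 _)).
rewrite big_imfset2 /=; last by move=> [? ?] [? ?] _ _ /= [-> ->].
rewrite (card_fset_sum1 A) big_distrl /=; apply: eq_bigr => x _.
by rewrite mul1n (card_fset_sum1 B).
Qed.

(** * Sumsets and Pluennecke's inequality *)

Section Sumset.
Variable V : zmodType.
Implicit Types A B C X : {fset V}.

Definition sumset A B : {fset V} := [fset a + b | a in A, b in B].
Definition oppset A : {fset V} := [fset - a | a in A].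
Definition nsumset n A : {fset V} := iter n (sumset A) [fset 0].

Lemma sumsetP A B x :
  reflect (exists a b, [/\ a \in A, b \in B & x = a + b]) (x \in sumset A B).
Proof.
apply: (iffP (imfset2P _ _ _ _ _)) => [[a aA [b bB ->]]|[a [b [aA bB ->]]]].
  by exists a, b.
by exists a => //; exists b.
Qed.

Lemma mem_sumset A B a b : a \in A -> b \in B -> a + b \in sumset A B.
Proof. by move=> aA bB; apply/sumsetP; exists a, b. Qed.

Lemma mem_oppset A a : (a \in oppset A) = (- a \in A).
Proof.
apply/imfsetP/idP => [[b bA ->]|aA]; first by rewrite opprK.
by exists (- a); rewrite ?opprK.
Qed.

Lemma sumsetC A B : sumset A B = sumset B A.
Proof.
by apply/fsetP=> x; apply/sumsetP/sumsetP => -[a [b [? ? ->]]];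
  exists b, a; rewrite addrC.
Qed.

Lemma sumsetA A B C : sumset A (sumset B C) = sumset (sumset A B) C.
Proof.
apply/fsetP=> x; apply/sumsetP/sumsetP => [[a [_ [aA /sumsetP[b [c [? ? ->]]] ->]]]|].
  by exists (a + b), c; rewrite mem_sumset // addrA.
move=> [_ [c [/sumsetP[a [b [? ? ->]]] cC ->]]].
by exists a, (b + c); rewrite mem_sumset // addrA.
Qed.

Lemma sumsetS A A' B B' : A `<=` A' -> B `<=` B' -> sumset A B `<=` sumset A' B'.
Proof.
move=> /fsubsetP AA /fsubsetP BB; apply/fsubsetP=> _ /sumsetP[a [b [aA bB ->]]].
by apply: mem_sumset; [exact: AA|exact: BB].
Qed.

Lemma sumsetU A B C : sumset A (B `|` C) = sumset A B `|` sumset A C.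
Proof.
apply/fsetP => x; rewrite in_fsetU; apply/sumsetP/orP => [[a [b []]]|].
  move=> aA; rewrite in_fsetU => /orP[] bB ->; [left|right]; exact: mem_sumset.
by case=> /sumsetP[a [b [? ? ->]]]; exists a, b; rewrite in_fsetU; split=> //;
  apply/orP; [left|right].
Qed.

Lemma card_sumset A B : (#|` sumset A B| <= #|` A| * #|` B|)%N.
Proof.
have := @fset_leq_card_rel _ _ (sumset A B) (A `*` B)
  (fun x p => x = p.1 + p.2); rewrite card_fsetM; apply.
- move=> _ /sumsetP[a [b [aA bB ->]]]; exists (a, b) => //.
  by rewrite inE /= aA bB.
- by move=> x x' p _ _ -> ->.
Qed.

Lemma card_sumset1 A c : #|` sumset A [fset c]| = #|` A|.
Proof.
have -> : sumset A [fset c] = [fset a + c | a in A].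
  apply/fsetP => x; apply/sumsetP/imfsetP => /=.
    by move=> [a [b [aA /fset1P-> ->]]]; exists a.
  by move=> [a aA ->]; exists a, c; rewrite fset11.
by rewrite card_imfset //=; exact: addIr.
Qed.

Lemma sumset0 A : sumset A [fset 0] = A.
Proof.
apply/fsetP => x; apply/sumsetP/idP => [[a [b [aA /fset1P-> ->]]]|xA].
  by rewrite addr0.
by exists x, 0; rewrite fset11 addr0.
Qed.

Lemma leq_card_sumset A B b : b \in B -> (#|` A| <= #|` sumset A B|)%N.
Proof.
move=> bB; rewrite -(card_sumset1 A b); apply: fsubset_leq_card.
by apply: sumsetS => //; rewrite fsub1set.
Qed.

(** Fix one representation d = a - b of every difference and send (x, d) to (x + a, x + b).
    Subtracting the two coordinates recovers d, hence a, hence x. *)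
Lemma ruzsa_triangle X A B :
  (#|` X| * #|` sumset A (oppset B)| <= #|` sumset X A| * #|` sumset X B|)%N.
Proof.
have /choice[f fP] : forall d, exists p : V * V, d \in sumset A (oppset B) ->
    [/\ p.1 \in A, p.2 \in B & d = p.1 - p.2].
  move=> d; case: (boolP (d \in sumset A (oppset B))) => [/sumsetP|_].
    by move=> [a [b [aA bB ->]]]; exists (a, - b) => _; rewrite /= opprK aA -mem_oppset bB.
  by exists (0, 0).
rewrite -!card_fsetM; apply: (@fset_leq_card_rel _ _ _ _
  (fun q r => r.1 = q.1 + (f q.2).1 /\ r.2 = q.1 + (f q.2).2)).
  move=> [x d]; rewrite inE /= => /andP[xX /fP[? ? _]].
  by exists (x + (f d).1, x + (f d).2); rewrite ?inE /= ?mem_sumset.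
move=> [x d] [x' d'] [r s]; rewrite !inE /=.
move=> /andP[_ /fP[_ _ dE]] /andP[_ /fP[_ _ d'E]] [-> ->] [E1 E2].
have dd : d = d'.
  rewrite dE d'E.
  have -> : (f d).1 - (f d).2 = (x + (f d).1) - (x + (f d).2).
    by rewrite opprD addrACA subrr add0r.
  by rewrite E1 E2 opprD addrACA subrr add0r.
by move: E1; rewrite dd => /addIr ->.
Qed.

(* Petridis: for X minimising |X + B| / |X|, adding C to X + B costs no more
   than adding it to X, by adding the elements of C one at a time. *)
Lemma petridis X B C :
  (forall Z, Z `<=` X -> (#|` sumset X B| * #|` Z| <= #|` sumset Z B| * #|` X|)%N) ->
  (#|` sumset (sumset X B) C| * #|` X| <= #|` sumset X B| * #|` sumset X C|)%N.
Proof.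
move=> Xmin; elim/fset1U_rect: C => [|c C _ IH].
  have -> : sumset (sumset X B) fset0 = fset0.
    by apply/fsetP=> x; rewrite inE; apply/negP => /sumsetP[a [b [_]]]; rewrite inE.
  by rewrite cardfs0.
rewrite fsetUC !sumsetU.
pose XB := sumset X B; pose XC := sumset X C.
(* [Z] consists of the x for which x + B + c adds nothing to X + B + C, and [Y] of those with x + c
   already in X + C. [Y] lies in [Z], and minimality of X bounds |Z + B| from below. *)
pose Z := [fset x in X | sumset (sumset [fset x] B) [fset c] `<=` sumset XB C].
pose Y := [fset x in X | x + c \in XC].
have YX : Y `<=` X by apply/fsubsetP=> x; rewrite !inE /= => /andP[].
have ZX : Z `<=` X by apply/fsubsetP=> x; rewrite !inE /= => /andP[].
have YZ : Y `<=` Z.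
  apply/fsubsetP => x; rewrite !inE /= => /andP[xX /sumsetP[y [d [yX dC E]]]].
  rewrite xX /=; apply/fsubsetP => _ /sumsetP[_ [_ [/sumsetP[_ [b [/fset1P-> bB ->]]] /fset1P-> ->]]].
  by rewrite addrAC E addrAC mem_sumset // mem_sumset.
have c1 : (#|` sumset XB C `|` sumset XB [fset c]| + #|` sumset Z B|
    <= #|` sumset XB C| + #|` XB|)%N.
  rewrite -(card_sumset1 XB c) -(cardfsUI (sumset XB C)) leq_add2l -(card_sumset1 (sumset Z B) c).
  apply: fsubset_leq_card; apply/fsubsetP => x.
  move=> /sumsetP[_ [_ [/sumsetP[z [b [zZ bB ->]]] /fset1P-> ->]]] {x}.
  rewrite inE; apply/andP; split.
    move: zZ; rewrite !inE /= => /andP[_ /fsubsetP]; apply.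
    by do 2!(apply: mem_sumset; rewrite ?fset11 //).
  by do 2!(apply: mem_sumset; rewrite ?fset11 ?(fsubsetP ZX) //).
have c2 : (#|` XC `|` sumset X [fset c]| + #|` Y| = #|` XC| + #|` X|)%N.
  rewrite -(card_sumset1 X c) -(cardfsUI XC) -(card_sumset1 Y c); congr (_ + #|` _|)%N.
  apply/fsetP => x; rewrite inE; apply/sumsetP/andP.
    move=> [y [_ [+ /fset1P-> ->]]]; rewrite !inE /= => /andP[yX ycC]; split => //.
    by apply: mem_sumset; rewrite ?fset11.
  move=> [xXC /sumsetP[y [_ [yX /fset1P-> E]]]]; exists y, c; rewrite fset11.
  by split=> //; rewrite !inE /= yX -E.
have h1 := Xmin Z ZX; have h2 := fsubset_leq_card YZ.
rewrite -/XB -/XC in h1 c1 c2 IH *.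
move: (#|` _ `|` sumset XB _|) (#|` _ `|` sumset X _|) c1 c2 => u v c1 c2.
nia.
Qed.

Lemma nsumsetS n A : nsumset n.+1 A = sumset A (nsumset n A).
Proof. by []. Qed.

Lemma nsumset1 A : nsumset 1 A = A.
Proof. exact: sumset0. Qed.

(** The ratio |X + B| / |X| is minimised over the nonempty subsets of [A]; the cross-multiplied
    inequality also covers empty Z. *)
Lemma exists_petridis_min A B : A != fset0 -> exists X,
  [/\ X `<=` A, X != fset0 &
   forall Z, Z `<=` A -> (#|` sumset X B| * #|` Z| <= #|` sumset Z B| * #|` X|)%N].
Proof.
move=> A0.
pose r (X : fpowerset A) : rat :=
  (#|` sumset (val X) B|)%:R / (#|` val X|)%:R.
have AA : A \in fpowerset A by rewrite fpowersetE.
have := @Order.TotalTheory.arg_minP _ _ _ [` AA]%fset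
  (fun X : fpowerset A => val X != fset0) r A0.
case=> X X0 Xmin; exists (val X); split=> //.
  by have := valP X; rewrite fpowersetE.
move=> Z ZA; case: (eqVneq Z fset0) => [->|Z0]; first by rewrite cardfs0 muln0.
have ZP : Z \in fpowerset A by rewrite fpowersetE.
have := Xmin [` ZP]%fset Z0; rewrite /r /=.
rewrite ler_pdivrMr ?ltr0n ?cardfs_gt0 // mulrAC ler_pdivlMr ?ltr0n ?cardfs_gt0 //.
by rewrite -!natrM ler_nat.
Qed.

(** For the minimiser X, [petridis] gives |X + jB| <= K^j |X| by induction on j. The Ruzsa triangle
    inequality through X then bounds mB - nB, and |X| <= |A|. *)
Lemma plunnecke (F : realFieldType) (K : F) A B m n :
  A != fset0 -> (#|` sumset A B|)%:R <= K * (#|` A|)%:R ->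
  (#|` sumset (nsumset m B) (oppset (nsumset n B))|)%:R
    <= K ^+ (m + n) * (#|` A|)%:R.
Proof.
move=> A0 AB.
have A1 : 0 < (#|` A|)%:R :> F by rewrite ltr0n cardfs_gt0.
have K0 : 0 <= K by rewrite -(pmulr_lge0 _ A1) (le_trans _ AB).
have [X [XA X0 Xmin]] := exists_petridis_min B A0.
have X1 : 0 < (#|` X|)%:R :> F by rewrite ltr0n cardfs_gt0.
have KX : (#|` sumset X B|)%:R <= K * (#|` X|)%:R.
  rewrite -(ler_pM2r A1) -natrM.
  apply: (@le_trans _ _ ((#|` sumset A B| * #|` X|)%:R)); first by rewrite ler_nat Xmin.
  by rewrite natrM mulrAC ler_pM2r.
have Xn j : (#|` sumset X (nsumset j B)|)%:R <= K ^+ j * (#|` X|)%:R.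
  elim: j => [|j IH]; first by rewrite sumset0 mul1r.
  have := @petridis X B (nsumset j B) (fun Z ZX => Xmin Z (fsubset_trans ZX XA)).
  rewrite -sumsetA -nsumsetS -(ler_nat F) !natrM => h.
  rewrite -(ler_pM2r X1) (le_trans h) // exprS -mulrA mulrAC.
  rewrite mulrC mulrA.
  apply: le_trans (ler_wpM2r _ IH) _; first by [].
  rewrite mulrC; apply: le_trans (ler_wpM2r _ KX) _.
    by rewrite mulr_ge0 ?exprn_ge0.
  by rewrite le_eqVlt; apply/orP; left; apply/eqP; ring.
have := ruzsa_triangle X (nsumset m B) (nsumset n B).
rewrite -(ler_nat F) !natrM => h.
rewrite -(ler_pM2l X1); apply: le_trans h _.
apply: (@le_trans _ _ ((K ^+ m * (#|` X|)%:R) * (K ^+ n * (#|` X|)%:R))).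
  by apply: ler_pM.
have -> : K ^+ m * (#|` X|)%:R * (K ^+ n * (#|` X|)%:R)
    = (#|` X|)%:R * (K ^+ (m + n) * (#|` X|)%:R) by rewrite exprD; ring.
by rewrite ler_pM2l // ler_wpM2l ?exprn_ge0 // ler_nat fsubset_leq_card.
Qed.

End Sumset.

(** * Cauchy--Schwarz, packing, and a structured family of fibres *)

Lemma leq_sqr_sum (I : finType) (f : I -> nat) :
  ((\sum_i f i) ^ 2 <= #|I| * \sum_i f i ^ 2)%N.
Proof.
rewrite -(@leq_pmul2l 2) // mulnA.
have -> : (2 * #|I| * \sum_i f i ^ 2 = \sum_i \sum_j (f i ^ 2 + f j ^ 2))%N.
  under [RHS]eq_bigr => i _ do rewrite big_split /= sum_nat_const.
  by rewrite big_split /= -big_distrr /= sum_nat_const addnn -mul2n mulnA.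
have -> : (2 * (\sum_i f i) ^ 2 = \sum_i \sum_j 2 * (f i * f j))%N.
  rewrite -mulnn big_distrlr /= big_distrr /=; apply: eq_bigr => i _.
  by rewrite big_distrr.
by apply: leq_sum => i _; apply: leq_sum => j _; rewrite nat_Cauchy.
Qed.

(** Cauchy--Schwarz applied to the number of sets [D i] containing u, as u runs over [U]. *)
Lemma leq_sqr_sum_card (I U : finType) (D : I -> {set U}) :
  ((\sum_i #|D i|) ^ 2 <= #|U| * \sum_i \sum_j #|D i :&: D j|)%N.
Proof.
have card_sum (B : {set U}) : #|B| = (\sum_u (u \in B))%N by rewrite -sum1_card big_mkcond.
have -> : (\sum_i #|D i| = \sum_u \sum_i (u \in D i))%N.
  by rewrite exchange_big /=; apply: eq_bigr => i _.
have -> : (\sum_i \sum_j #|D i :&: D j| = \sum_u (\sum_i (u \in D i)) ^ 2)%N.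
  under eq_bigr => i _ do under eq_bigr => j _ do rewrite card_sum.
  under eq_bigr => i _ do rewrite exchange_big /=.
  rewrite exchange_big /=; apply: eq_bigr => u _.
  rewrite -mulnn big_distrlr /=; apply: eq_bigr => i _; apply: eq_bigr => j _.
  by rewrite inE mulnb.
exact: leq_sqr_sum.
Qed.

(** [W] is a maximal set of indices with pairwise disjoint [D k]. Disjointness bounds its size, and
    maximality makes every other nonempty [D k] meet a chosen one. *)
Lemma maximal_packing (K U : finType) (K0 : {set K}) (D : K -> {set U}) (c d : nat) :
  (forall k, k \in K0 -> d <= c * #|D k|)%N ->
  exists W : {set K}, [/\ (#|W| * d <= c * #|U|)%N, W \subset K0 &
    forall k, k \in K0 -> D k != set0 -> exists2 w, w \in W & D k :&: D w != set0].
Proof.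
move=> Dd.
pose P (W : {set K}) := (W \subset K0) &&
  [forall i in W, forall j in W, (i != j) ==> (D i :&: D j == set0)].
have P0 : P set0.
  by rewrite /P sub0set /=; apply/forall_inP => i; rewrite inE.
have [W /maxsetP[/andP[WK0 /forall_inP Wdisj] Wmax]] := ex_maxset (ex_intro P _ P0).
exists W; split=> //.
  have card_sum (B : {set U}) : #|B| = (\sum_u (u \in B))%N by rewrite -sum1_card big_mkcond.
  apply: (@leq_trans (\sum_(k in W) c * #|D k|)).
    by rewrite -sum_nat_const; apply: leq_sum => k kW; apply/Dd/(subsetP WK0).
  rewrite -big_distrr leq_mul2l; apply/orP; right.
  under eq_bigr => k _ do rewrite card_sum.
  rewrite exchange_big /= -sum1_card; apply: leq_sum => u _.
  case: (pickP (fun k => (k \in W) && (u \in D k))) => [k /andP[kW ukD]|none]; last first.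
    by rewrite big1 // => k kW; have := none k; rewrite kW /= => ->.
  rewrite (bigD1 k) //= ukD big1 ?addn0 // => j /andP[jW jk].
  have /forall_inP/(_ j jW) := Wdisj k kW; rewrite eq_sym jk /= => /eqP E.
  apply/eqP; rewrite eqb0; apply/negP => ujD.
  by have := in_set0 u; rewrite -E inE ukD ujD.
move=> k kK0 Dk0; case: (boolP (k \in W)) => [kW|kW].
  by exists k; rewrite ?setIid.
apply/exists_inP; apply: contraR kW; rewrite negb_exists_in => /forall_inP nk.
have <- : k |: W = W; last by rewrite setU11.
apply: Wmax; last exact: subsetUr.
rewrite /P subUset sub1set kK0 WK0 /=.
apply/forall_inP => i; rewrite !inE => iW; apply/forall_inP => j; rewrite !inE => jW.
apply/implyP => ij; case/orP: iW ij => [/eqP->|iW]; case/orP: jW => [/eqP->|jW].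
- by rewrite eqxx.
- by have := nk j jW; rewrite negbK.
- by have := nk i iW; rewrite negbK setIC.
- by move=> ij; have /forall_inP/(_ j jW) := Wdisj i iW; rewrite ij.
Qed.

(* By Cauchy--Schwarz some translate A of a fibre meets translates of many other
   fibres in sets C_i with [t^2 / (2 u)] elements.  The sets C_i + C_j + g_ij, g
   being suitably translated, lie in L, so a maximal disjoint subfamily has at
   most 2 K^2 members; hence G := W + 2A - 2A with |W| <= 2 K^2 contains all g_ij. *)
Lemma structured_subfamily (F : realFieldType) (V : zmodType) (I : finType) (A : I -> {fset V})
    (g : I -> I -> V) (L : {fset V}) (t : nat) :
  (0 < t)%N -> (0 < #|I|)%N -> (forall i, #|` A i| = t) ->
  (forall i j a b, a \in A i -> b \in A j -> a + b + g i j \in L) ->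
  exists (X : {set I}) (s : I -> V) (G : {fset V}),
  [/\ (#|I| * t <= 2 * #|` L| * #|X|)%N,
      forall i j, i \in X -> j \in X -> g i j + s i + s j \in G &
      (#|` sumset (nsumset 4 G) (oppset (nsumset 4 G))|)%:R
        <= (2%:R * ((#|` L|)%:R / t%:R) ^+ 7) ^+ 8 * t%:R :> F].
Proof.
move=> t0 /card_gt0P[i0 _] At gL.
have [b0 b0A] : exists b0, b0 \in A i0.
  by apply/fset0Pn; rewrite -cardfs_gt0 At.
(* With this shift A_i + s_i = A_i + b0 + g(i, i0) lies inside [L], so all the translates [D i] live
   in a common set of size u. *)
pose s i := g i i0 + b0.
pose D i := sumset (A i) [fset s i].
have DP i a : (a \in D i) = (a - s i \in A i).
  apply/sumsetP/idP => [[x [_ [xA /fset1P-> ->]]]|aA]; first by rewrite addrK.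
  by exists (a - s i), (s i); rewrite fset11 subrK.
have Dt i : #|` D i| = t by rewrite card_sumset1.
have DL i : D i `<=` L.
  apply/fsubsetP => a; rewrite DP => /gL/(_ b0A).
  by rewrite /s opprD addrA !subrK.
pose E i := fsub L (D i).
have Et i : #|E i| = t by rewrite card_fsub.
set u := #|` L|.
have ut : (t <= u)%N by rewrite -(Dt i0) fsubset_leq_card.
have cardL : #|{: L}| = u by rewrite -cardfE.
have [j0 j0P] : exists j, (#|I| * t ^ 2 <= u * \sum_i #|E i :&: E j|)%N.
  case: (pickP (fun j => #|I| * t ^ 2 <= u * \sum_i #|E i :&: E j|)%N) => [j|H].
    by exists j.
  have := leq_sqr_sum_card E; rewrite (eq_bigr _ (fun i _ => Et i)) sum_nat_const cardL.
  rewrite exchange_big /= big_distrr /= => HH; exfalso; move: HH.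
  apply/negP; rewrite -ltnNge.
  apply: (@leq_trans (\sum_(j : I) #|I| * t ^ 2)); last first.
    by rewrite sum_nat_const expnMn -[(#|I| ^ 2)%N]mulnn mulnA.
  rewrite (bigD1 i0) //= [ltnRHS](bigD1 i0) //=.
  rewrite -addSn; apply: leq_add; first by rewrite ltnNge H.
  by apply: leq_sum => j _; apply: ltnW; rewrite ltnNge H.
(* Indices outside [X] contribute less than t^2 / (2u) each, so at most half of the sum over i found
   above. *)
pose X := [set i | t ^ 2 <= 2 * u * #|E i :&: E j0|]%N.
have EI i : (#|E i :&: E j0| <= t)%N by rewrite -(Et i) subset_leq_card // subsetIl.
have XM : (#|I| * t <= 2 * u * #|X|)%N.
  have : (2 * (#|I| * t ^ 2) <= 2 * u * t * #|X| + #|I| * t ^ 2)%N.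
    apply: (leq_trans (n := 2 * (u * \sum_i #|E i :&: E j0|))); first by rewrite leq_mul2l.
    have -> : (#|X| = \sum_i (i \in X))%N by rewrite -sum1_card big_mkcond.
    rewrite mulnA !big_distrr /= -sum_nat_const -big_split /=; apply: leq_sum => i _.
    rewrite inE; case: (leqP (t ^ 2)) => [_|/ltnW]; last by rewrite muln0.
    by rewrite muln1 (leq_trans _ (leq_addr _ _)) // leq_mul2l EI orbT.
  have : (0 < t)%N by []; nia.
have [A0 AE] : exists A0, A0 = D j0 by exists (D j0).
pose C i := D i `&` A0.
have Cc i : #|` C i| = #|E i :&: E j0|.
  have -> : E i :&: E j0 = fsub L (C i).
    by apply/setP => x; rewrite !inE AE.
  rewrite card_fsub //; exact: fsubset_trans (fsubsetIl _ _) (DL i).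
pose g' i j := g i j - s i - s j.
have g'P i j a b : a \in D i -> b \in D j -> a + b + g' i j \in L.
  rewrite !DP => aA /(gL _ _ _ _ aA).
  by rewrite addrACA /g' -[g i j - s i - s j]addrA [g i j + _]addrC !addrA.
pose E2 (k : I * I) := fsub L (sumset (sumset (C k.1) (C k.2)) [fset g' k.1 k.2]).
have E2L (k : I * I) : sumset (sumset (C k.1) (C k.2)) [fset g' k.1 k.2] `<=` L.
  apply/fsubsetP => _ /sumsetP[_ [_ [/sumsetP[a [b [+ + ->]]] /fset1P-> ->]]].
  by rewrite !inE => /andP[? _] /andP[? _]; apply: g'P.
have E2c k : (#|` C k.1| <= #|E2 k| \/ C k.2 = fset0)%N.
  case: (fset_0Vmem (C k.2)) => [->|[b bC]]; [by right|left].
  by rewrite card_fsub // card_sumset1 (leq_card_sumset _ bC).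
have XC i : i \in X -> (t ^ 2 <= 2 * u * #|` C i|)%N by rewrite inE Cc.
have XC0 i : i \in X -> C i != fset0.
  move=> /XC; apply: contraTneq => ->; rewrite cardfs0 muln0 -ltnNge expn_gt0 t0 //.
have [] := @maximal_packing _ _ (setX X X) E2 (2 * u) (t ^ 2).
  move=> [i j]; rewrite inE /= => /andP[iX jX]; apply: leq_trans (XC _ iX) _.
  case: (E2c (i, j)) => /= [H|/eqP]; last by rewrite (negPf (XC0 _ jX)).
  by rewrite leq_mul2l H orbT.
rewrite cardL => W [Wc WX Wmeet].
pose S := sumset (nsumset 2 A0) (oppset (nsumset 2 A0)).
pose W0 := [fset g' w.1 w.2 | w in W].
exists X, (fun i => - s i), (sumset W0 S); split=> //.
  move=> i j iX jX; have ijX : (i, j) \in setX X X by rewrite inE iX.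
  have := Wmeet _ ijX; case.
    have [a aC] := fset0Pn _ (XC0 _ iX); have [b bC] := fset0Pn _ (XC0 _ jX).
    rewrite -card_gt0 card_fsub // cardfs_gt0; apply/fset0Pn.
    by exists (a + b + g' i j); do 2?apply: mem_sumset; rewrite ?fset11.
  move=> w wW /set0Pn[x]; rewrite !inE => /andP[].
  move=> /sumsetP[_ [_ [/sumsetP[a [b [aC bC ->]]] /fset1P-> ->]]].
  move=> /sumsetP[_ [_ [/sumsetP[c [d [cC dC ->]]] /fset1P-> /= E3]]].
  (* A common element a + b + g'(i, j) = c + d + g'(w) expresses g'(i, j) as an element of W0 + 2 A0
     - 2 A0. *)
  have -> : g i j - s i - s j = g' w.1 w.2 + (c + d + - (a + b)).
    by apply: (addIr (a + b)); rewrite -[RHS]addrA subrK [RHS]addrC -E3 addrC.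
  have CA k y : y \in C k -> y \in A0 by rewrite inE => /andP[].
  apply: mem_sumset; first by apply/imfsetP; exists w.
  have A2 y z : y \in A0 -> z \in A0 -> y + z \in nsumset 2 A0.
    by move=> yA zA; rewrite nsumsetS nsumset1 mem_sumset.
  by apply: mem_sumset; rewrite ?mem_oppset ?opprK; apply: A2; apply: CA; eassumption.
have A0t : #|` A0| = t by rewrite AE Dt.
have A0n : A0 != fset0 by rewrite -cardfs_gt0 A0t.
have tR : 0 < t%:R :> F by rewrite ltr0n.
set K : F := u%:R / t%:R.
have K0 : 0 <= K by rewrite divr_ge0.
have KA : (#|` sumset A0 A0|)%:R <= K * (#|` A0|)%:R.
  rewrite A0t /K divfK ?gt_eqF // ler_nat -(card_sumset1 _ (g' j0 j0)).
  apply: fsubset_leq_card; apply/fsubsetP.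
  move=> _ /sumsetP[_ [_ [/sumsetP[a [b [aA bA ->]]] /fset1P-> ->]]].
  by apply: g'P; rewrite -AE.
have := plunnecke 3 2 A0n KA; rewrite A0t => KS.
have W0c : (#|` W0|)%:R <= 2 * K ^+ 2.
  apply: (@le_trans _ _ (#|W|%:R)).
    by rewrite ler_nat (leq_trans (leq_imfset_card _ _ _)) // -cardE.
  rewrite /K expr_div_n mulrA ler_pdivlMr ?exprn_gt0 //.
  rewrite -!natrX -!natrM ler_nat -[(u ^ 2)%N]mulnn mulnA; exact: Wc.
(* A0 + G = W0 + (3 A0 - 2 A0) has at most 2 K^2 * K^5 t elements, so the inequality can be applied
   once more, with [G] as the summand. *)
have KG : (#|` sumset A0 (sumset W0 S)|)%:R <= 2 * K ^+ 7 * (#|` A0|)%:R.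
  rewrite A0t sumsetA [sumset A0 W0]sumsetC -sumsetA.
  apply: le_trans (_ : (#|` W0| * #|` sumset A0 S|)%:R <= _).
    by rewrite ler_nat card_sumset.
  rewrite natrM; apply: le_trans (ler_pM _ _ W0c (_ : _ <= K ^+ 5 * t%:R)) _ => //.
    by rewrite /S sumsetA -nsumsetS.
  by rewrite le_eqVlt; apply/orP; left; apply/eqP; ring.
by have := plunnecke 4 4 A0n KG; rewrite A0t.
Qed.

(** * Noncrossing geometric graphs and Szemeredi--Trotter *)

Section PlaneGraph.
Variables (R : realFieldType) (T E : finType).

Definition height (s w : T -> R) (src : E -> T) (sl : E -> R) e x :=
  w (src e) + sl e * (x - s (src e)).

(** Straight-line drawing with vertex p at (s p, w p) and edges directed from left to right. The
    conditions only concern [V] and [F], while [height] extends each edge to its full line. *)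
Record plane_graph (s w : T -> R) (src tgt : E -> T) (sl : E -> R)
    (V : {set T}) (F : {set E}) : Prop := PlaneGraph {
  pg_inj : forall p q, s p = s q -> w p = w q -> p = q;
  pg_src : forall e, e \in F -> src e \in V;
  pg_tgt : forall e, e \in F -> tgt e \in V;
  pg_lt : forall e, e \in F -> s (src e) < s (tgt e);
  pg_end : forall e, e \in F -> height s w src sl e (s (tgt e)) = w (tgt e);
  pg_vertex : forall e v, e \in F -> v \in V -> s (src e) < s v < s (tgt e) ->
    w v <> height s w src sl e (s v);
  pg_edge : forall e f x, e \in F -> f \in F -> e != f ->
    s (src e) < x < s (tgt e) -> s (src f) < x < s (tgt f) ->
    height s w src sl e x <> height s w src sl f x }.

(** Reflection in the horizontal axis; it turns a vertex on the lower side of a wedge into one on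
    the upper side. *)
Lemma plane_graph_opp s w src tgt sl V F : plane_graph s w src tgt sl V F ->
  plane_graph s (fun p => - w p) src tgt (fun e => - sl e) V F.
Proof.
have hE e x : height s (fun p => - w p) src (fun e => - sl e) e x =
  - height s w src sl e x by rewrite /height; ring.
move=> [h1 h2 h3 h4 h5 h6 h7]; split=> // [p q pq /oppr_inj|e eF|e v eF vV ev|].
- exact: h1.
- by rewrite hE h5.
- by rewrite hE => /oppr_inj; apply: h6.
- by move=> e f x eF fF ef ex fx; rewrite !hE => /oppr_inj; apply: h7.
Qed.

Section Charging.
Variables (s w : T -> R) (src tgt : E -> T) (sl : E -> R).
Variables (V : {set T}) (F : {set E}).
Hypothesis G : plane_graph s w src tgt sl V F.
Local Notation ht := (height s w src sl).

Lemma height_src e : ht e (s (src e)) = w (src e).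
Proof. by rewrite /height subrr mulr0 addr0. Qed.

Lemma height_tgt e x : e \in F -> ht e x = w (tgt e) + sl e * (x - s (tgt e)).
Proof. by move=> eF; rewrite -(pg_end G eF) /height; ring. Qed.

(** The difference of two affine functions that changes sign on (a, b) vanishes at an explicit
    interior point, which [pg_edge] forbids. *)
Lemma no_crossing e f a b : e \in F -> f \in F -> a < b ->
  s (src e) <= a -> s (src f) <= a -> b <= s (tgt e) -> b <= s (tgt f) ->
  ht e a < ht f a -> ht f b < ht e b -> False.
Proof.
move=> eF fF ab ea fa eb fb hab hba.
have ef : e != f by apply: contraTneq hab => ->; rewrite ltxx.
pose A := ht f a - ht e a; pose B := ht e b - ht f b.
have A0 : 0 < A by rewrite subr_gt0.
have B0 : 0 < B by rewrite subr_gt0.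
pose r := A / (A + B).
have rE : r * (A + B) = A by rewrite /r divfK // gt_eqF // addr_gt0.
have r0 : 0 < r by rewrite divr_gt0 // addr_gt0.
have r1 : r < 1 by rewrite ltr_pdivrMr ?mul1r ?ltrDl // addr_gt0.
pose x := a + (b - a) * r.
have xa : a < x by rewrite ltrDl mulr_gt0 // subr_gt0.
have xb : x < b by rewrite /x -ltrBrDl gtr_pMr // subr_gt0.
apply: (pg_edge G (x := x) eF fF ef).
- by rewrite (le_lt_trans ea xa) (lt_le_trans xb eb).
- by rewrite (le_lt_trans fa xa) (lt_le_trans xb fb).
have lin g : ht g x = ht g a + (ht g b - ht g a) * r by rewrite /height /x; ring.
rewrite !lin; move: rE; rewrite /A /B => rE; lra.
Qed.

Lemma src_slope_inj e f : e \in F -> f \in F -> src e = src f -> sl e = sl f -> e = f.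
Proof.
move=> eF fF se ss; apply/eqP/negPn/negP => ef.
have le := pg_lt G eF; have lf := pg_lt G fF; rewrite -se in lf.
wlog h : e f eF fF se ss ef le lf / s (tgt e) <= s (tgt f).
  move=> W; case: (leP (s (tgt e)) (s (tgt f))) => [|/ltW] H.
    exact: (W e f).
  by apply: (W f e) => //; rewrite 1?eq_sym -?se.
apply: (pg_edge G (x := (s (src e) + s (tgt e)) / 2) eF fF ef); rewrite -?se.
- by rewrite midf_lt //= midf_lt.
- by rewrite midf_lt //= (lt_le_trans _ h) // midf_lt.
- by rewrite /height se ss.
Qed.

Lemma tgt_slope_inj e f : e \in F -> f \in F -> tgt e = tgt f -> sl e = sl f -> e = f.
Proof.
move=> eF fF se ss; apply/eqP/negPn/negP => ef.
have le := pg_lt G eF; have lf := pg_lt G fF; rewrite -se in lf.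
wlog h : e f eF fF se ss ef le lf / s (src f) <= s (src e).
  move=> W; case: (leP (s (src f)) (s (src e))) => [|/ltW] H.
    exact: (W e f).
  by apply: (W f e) => //; rewrite 1?eq_sym -?se.
apply: (pg_edge G (x := (s (src e) + s (tgt e)) / 2) eF fF ef); rewrite -?se.
- by rewrite midf_lt //= midf_lt.
- by rewrite (le_lt_trans h) /= midf_lt.
- by rewrite !height_tgt // se ss.
Qed.

(** For e' leaving the source of e with smaller slope, this is the closed triangle between the two
    edges, without its apex, cut off where the shorter edge ends. *)
Definition in_wedge e e' v := [/\ v \in V, s (src e) < s v,
  s v <= s (tgt e), s v <= s (tgt e') & ht e' (s v) <= w v <= ht e (s v)].

Definition first_in_wedge e e' v :=
  in_wedge e e' v /\ forall y, in_wedge e e' y -> s v <= s y.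

(** A vertex on e is not interior to e, so v is its target. An edge into v steeper than e runs below
    e; it either starts inside the wedge before v, contradicting minimality, or passes below the
    apex and crosses e'. *)
Lemma first_in_wedge_top e e' v : e \in F -> e' \in F -> src e' = src e ->
  sl e' < sl e -> first_in_wedge e e' v -> w v = ht e (s v) ->
  v = tgt e /\ forall f, f \in F -> tgt f = v -> sl f <= sl e.
Proof.
move=> eF e'F se sle [[vV pv ve ve' /andP[ev' _]] vmin] wv.
have vE : v = tgt e.
  have sv : s v = s (tgt e).
    apply/eqP; rewrite eq_le ve leNgt; apply/negP => lt.
    by apply: (pg_vertex G eF vV); rewrite ?pv.
  by apply: (pg_inj G) => //; rewrite wv sv (pg_end G).
split=> // f fF fv; rewrite leNgt; apply/negP => slf.
have lf := pg_lt G fF; rewrite fv in lf.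
have below x : x < s v -> ht f x < ht e x.
  by move=> xv; rewrite !height_tgt // fv -vE; nra.
have ev'_lt : ht e' (s v) < ht f (s v).
  rewrite [ht f _]height_tgt // fv subrr mulr0 addr0 wv /height se.
  nra.
have e'e : ht e' (s (src e)) = ht e (s (src e)) by rewrite -{1}se !height_src se.
have stop x : x < s v -> s (src e) <= x -> s (src f) <= x -> ht e' x <= ht f x.
  move=> xv ex fx; rewrite leNgt; apply/negP => lt'.
  by apply: (@no_crossing f e' x (s v)); rewrite ?se ?fv.
case: (ltP (s (src e)) (s (src f))) => [ef|fe].
  have : s v <= s (src f).
    apply: vmin; split=> //; first exact: (pg_src G fF).
    - by rewrite (le_trans (ltW lf)).
    - by rewrite (le_trans (ltW lf)).
    - by rewrite -height_src (stop _ lf (ltW ef) (lexx _)) /= ltW // below.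
  by rewrite leNgt lf.
have := stop _ pv (lexx _) fe.
by rewrite e'e leNgt below.
Qed.

(** If the source of e2 lay below e1', then e2 would cross e1' before v; if above e1, then e2' would
    cross e1. So it lies between them, and being left of v it can only be the apex of the first
    wedge. *)
Lemma first_in_wedge_inner e1 e1' e2 e2' v :
  e1 \in F -> e1' \in F -> e2 \in F -> e2' \in F ->
  src e1' = src e1 -> src e2' = src e2 ->
  first_in_wedge e1 e1' v -> first_in_wedge e2 e2' v ->
  ht e1' (s v) < w v < ht e1 (s v) -> ht e2' (s v) < w v < ht e2 (s v) ->
  s (src e1) <= s (src e2) -> src e1 = src e2.
Proof.
move=> F1 F1' F2 F2' se1 se2 [[vV pv1 v1 v1' _] vmin] [[_ pv2 v2 v2' _] _].
move=> /andP[h1' h1] /andP[h2' h2] s12.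
case: (ltP (w (src e2)) (ht e1' (s (src e2)))) => [lo|lo].
  exfalso; apply: (@no_crossing e2 e1' (s (src e2)) (s v)) => //; rewrite ?se1 //.
    by rewrite height_src.
  exact: lt_trans h1' h2.
case: (ltP (ht e1 (s (src e2))) (w (src e2))) => [hi|hi].
  exfalso; apply: (@no_crossing e1 e2' (s (src e2)) (s v)) => //; rewrite ?se2 //.
    by rewrite -{2}se2 height_src se2.
  exact: lt_trans h2' h1.
move: s12; rewrite le_eqVlt => /orP[/eqP s12|s12].
  apply: (pg_inj G) => //; apply/eqP; rewrite eq_le.
  by move: lo hi; rewrite -s12 -{1}se1 !height_src se1 => -> ->.
have : s v <= s (src e2).
  apply: vmin; split=> //; first exact: (pg_src G F2).
  - exact: le_trans (ltW pv2) _.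
  - exact: le_trans (ltW pv2) _.
  - by rewrite lo hi.
by rewrite leNgt pv2.
Qed.

Definition next_below e e' := [/\ e' \in F, src e' = src e, sl e' < sl e &
  forall f, f \in F -> src f = src e -> sl f < sl e -> sl f <= sl e'].

Lemma next_below_slope e1 e2 e' : e1 \in F ->
  next_below e1 e' -> next_below e2 e' -> sl e2 <= sl e1.
Proof.
move=> F1 [_ s1 l1 _] [_ s2 _ n2]; rewrite leNgt; apply/negP => lt.
by have := n2 e1 F1 (etrans (esym s1) s2) lt; rewrite leNgt l1.
Qed.

Lemma next_below_inj e1 e2 e' : e1 \in F -> e2 \in F ->
  next_below e1 e' -> next_below e2 e' -> e1 = e2.
Proof.
move=> F1 F2 n1 n2; apply: src_slope_inj => //.
  by case: n1 n2 => _ <- _ _ [_ <-].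
by apply/le_anti; rewrite !(@next_below_slope _ _ e').
Qed.

Lemma exists_first_in_wedge e e' : e \in F -> next_below e e' ->
  exists v, first_in_wedge e e' v.
Proof.
move=> eF [e'F se sle _]; have le := pg_lt G eF; have le' := pg_lt G e'F.
rewrite se in le'.
have mono x : s (src e) < x -> ht e' x < ht e x by move=> lx; rewrite /height se; nra.
have [v0 v0W] : exists v, in_wedge e e' v.
  case: (leP (s (tgt e)) (s (tgt e'))) => [|/ltW] h.
    exists (tgt e); split=> //; first exact: (pg_tgt G).
    by rewrite -(pg_end G eF) lexx ltW // mono.
  exists (tgt e'); split=> //; first exact: (pg_tgt G).
  by rewrite -(pg_end G e'F) lexx ltW // mono.
have := @Order.TotalTheory.arg_minP _ _ _ v0 (fun v => `[< in_wedge e e' v >]) s.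
case=> [|v /asboolP vW vmin]; first exact/asboolP.
by exists v; split=> // y yW; apply: vmin; apply/asboolP.
Qed.

Lemma first_in_wedge_inner_slope e1 e1' e2 e2' v : e1 \in F -> e2 \in F ->
  next_below e1 e1' -> next_below e2 e2' ->
  first_in_wedge e1 e1' v -> first_in_wedge e2 e2' v ->
  ht e1' (s v) < w v < ht e1 (s v) -> ht e2' (s v) < w v < ht e2 (s v) ->
  sl e2 <= sl e1.
Proof.
move=> F1 F2 [F1' se1 _ _] [F2' se2 _ n2] v1 v2 i1 i2.
have s12 : src e1 = src e2.
  case: (leP (s (src e1)) (s (src e2))) => [|/ltW] h.
    exact: (@first_in_wedge_inner e1 e1' e2 e2' v).
  by apply/esym; exact: (@first_in_wedge_inner e2 e2' e1 e1' v).
rewrite leNgt; apply/negP => lt.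
have := n2 e1 F1 s12 lt.
case/andP: i1 => _; case/andP: i2 => + _.
case: v1 => [[_ pv _ _ _] _].
rewrite /height se2 -s12; nra.
Qed.

End Charging.

(* Each edge e is charged to a vertex: to its source if it is the lowest edge
   leaving it; otherwise to the leftmost vertex v in the wedge between e and the
   next edge e' below e at the same source.  As nothing crosses e or e', v
   determines e in each of the three cases: v on e, v on e', v strictly inside. *)
Lemma plane_graph_card s w src tgt sl V F :
  plane_graph s w src tgt sl V F -> (#|F| <= 4 * #|V|)%N.
Proof.
move=> G; have G' := plane_graph_opp G.
pose ht := height s w src sl.
pose below := next_below src sl F.
(* In cases 1 and 2 the vertex determines e as its incoming edge of largest slope, respectively e'
   as its incoming edge of smallest slope. *)
pose charged (e : E) (kv : 'I_4 * T) := match val kv.1 with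
  | 0 => kv.2 = src e /\ forall f, f \in F -> src f = src e -> sl e <= sl f
  | 1 => kv.2 = tgt e /\ forall f, f \in F -> tgt f = kv.2 -> sl f <= sl e
  | 2 => exists e', [/\ below e e', kv.2 = tgt e' &
           forall f, f \in F -> tgt f = kv.2 -> sl e' <= sl f]
  | _ => exists e', [/\ below e e', first_in_wedge s w src tgt sl V e e' kv.2 &
           ht e' (s kv.2) < w kv.2 < ht e (s kv.2)]
  end.
have charged_inj e f kv : e \in F -> f \in F -> charged e kv -> charged f kv -> e = f.
  case: kv => -[[|[|[|[|//]]]] lt4] v eF fF; rewrite /charged /=.
  - move=> [-> emin] [ef fmin]; apply: (src_slope_inj G) => //.
    by apply/le_anti; rewrite emin ?fmin.
  - move=> [-> emax] [ef fmax]; apply: (tgt_slope_inj G) => //.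
    by apply/le_anti; rewrite emax ?fmax.
  - move=> [e' [ee' -> emin]] [f' [ff' ef fmin]].
    have [e'F _ _ _] := ee'; have [f'F _ _ _] := ff'.
    have e'f' : e' = f'.
      apply: (tgt_slope_inj G) => //.
      by apply/le_anti; rewrite emin ?fmin.
    by apply: (next_below_inj G eF fF ee'); rewrite e'f'.
  - move=> [e' [ee' ev ein]] [f' [ff' fv fin]].
    have ef : src e = src f.
      have [e'F se' _ _] := ee'; have [f'F sf' _ _] := ff'.
      case: (leP (s (src e)) (s (src f))) => [|/ltW] h.
        exact: (first_in_wedge_inner G eF e'F fF f'F se' sf' ev fv).
      exact/esym/(first_in_wedge_inner G fF f'F eF e'F sf' se' fv ev).
    apply: (src_slope_inj G) => //; apply/le_anti/andP; split.
      exact: (first_in_wedge_inner_slope G fF eF ff' ee' fv ev).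
    exact: (first_in_wedge_inner_slope G eF fF ee' ff' ev fv).
have chargedP e : e \in F -> exists2 kv, kv.2 \in V & charged e kv.
  move=> eF.
  case: (pickP (fun f => [&& f \in F, src f == src e & sl f < sl e])) => [f0 f0P|low]; last first.
    exists (inord 0, src e) => /=; first exact: (pg_src G).
    rewrite /charged /= inordK //; split=> // f fF fe; rewrite leNgt; apply/negP => lt.
    by have := low f; rewrite fF fe eqxx lt.
  have := @Order.TotalTheory.arg_maxP _ _ _ f0
    (fun f => [&& f \in F, src f == src e & sl f < sl e]) sl f0P.
  case=> e' /and3P[e'F /eqP se sle] emax.
  have ee' : below e e'.
    by split=> // f fF fe lt; apply: emax; rewrite fF fe eqxx lt.
  have [v vW] := exists_first_in_wedge G eF ee'.
  have [[vV pv ve ve' /andP[ev' ev]] vmin] := vW.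
  case: (eqVneq (w v) (ht e (s v))) => [top|top].
    have [vE vmax] := first_in_wedge_top G eF e'F se sle vW top.
    exists (inord 1, v) => //; rewrite /charged /= inordK //.
  case: (eqVneq (w v) (ht e' (s v))) => [bot|bot].
    have hE g x : height s (fun p => - w p) src (fun e => - sl e) g x = - ht g x.
      by rewrite /ht /height; ring.
    have [] := @first_in_wedge_top _ _ _ _ _ _ _ G' e' e v e'F eF (esym se).
    - by rewrite ltrN2.
    - split; first by split; rewrite ?se // !hE !lerN2 ev' ev.
      move=> y [yV y1 y2 y3]; rewrite !hE !lerN2 => /andP[y4 y5].
      by apply: vmin; split; rewrite -?se // y4 y5.
    - by rewrite hE bot.
    move=> vE vmin'; exists (inord 2, v) => //; rewrite /charged /= inordK //.
    by exists e'; split=> // f fF fv; rewrite -lerN2; apply: vmin'.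
  exists (inord 3, v) => //; rewrite /charged /= inordK //.
  by exists e'; split=> //; rewrite !lt_neqAle top ev eq_sym bot ev'.
case: (set_0Vmem F) => [->|[e0 e0F]]; first by rewrite cards0.
have /choice[c cP] : forall e, exists kv, e \in F -> kv.2 \in V /\ charged e kv.
  move=> e; case: (boolP (e \in F)) => [/chargedP[kv]|_]; first by exists kv.
  by exists (ord0, src e0).
have <- : #|c @: F| = #|F|.
  apply: card_in_imset => e f eF fF ef.
  by apply: (charged_inj _ _ (c e)) => //; [have [] := cP e eF|rewrite ef; have [] := cP f fF].
have -> : (4 * #|V| = #|setX [set: 'I_4] V|)%N by rewrite cardsX cardsT card_ord.
apply/subset_leq_card/subsetP => _ /imsetP[e eF ->].
by rewrite !inE; have [] := cP e eF.
Qed.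

End PlaneGraph.

(** * Averaging over random colourings *)

Lemma card_ffun_const_on (T : finType) (k : nat) (B : {set T}) :
  (#|[set f : {ffun T -> 'I_k.+1} | [forall x in B, f x == ord0]]| * k.+1 ^ #|B|
    = k.+1 ^ #|T|)%N.
Proof.
pose F x : pred 'I_k.+1 := if x \in B then pred1 ord0 else predT.
have -> : #|[set f : {ffun T -> 'I_k.+1} | [forall x in B, f x == ord0]]|
    = #|(family F : pred {ffun T -> 'I_k.+1})|.
  rewrite cardsE; apply: eq_card => f; apply/forall_inP/familyP => H x.
    by rewrite /F; case: ifP => // /H.
  by move=> xB; have := H x; rewrite /F xB.
rewrite card_family foldrE big_map big_enum /=.
rewrite (bigID (mem B)) /= big1 ?mul1n; last first.
  by move=> x xB; rewrite /F xB card1.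
rewrite (eq_bigr (fun _ => k.+1)); last first.
  by move=> x xB; rewrite /F (negPf xB) cardT size_enum_ord.
rewrite prod_nat_const -expnD; congr (_ ^ _)%N.
by rewrite -(cardC (mem B)) addnC; congr (_ + _)%N; apply: eq_card.
Qed.

(* Apply the bound to the vertices of colour 0, averaging over all colourings
   with [k.+1] colours. *)
Lemma leq_sampling (T A C : finType) (F : {set A}) (B : A -> {set T})
    (D : C -> {set T}) (k : nat) :
  (forall a, a \in F -> #|B a| <= 2)%N -> (forall c, #|D c| = 4) ->
  (forall V : {set T}, #|[set a in F | B a \subset V]|
      <= 4 * #|V| + #|[set c | D c \subset V]|)%N ->
  (#|F| * k.+1 ^ 2 <= 4 * #|T| * k.+1 ^ 3 + #|C|)%N.
Proof.
move=> B2 D4 bound.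
pose zeros (f : {ffun T -> 'I_k.+1}) := [set x | f x == ord0].
pose N (S : {set T}) := #|[set f : {ffun T -> 'I_k.+1} | [forall x in S, f x == ord0]]|.
have NE S : N S = (\sum_f (S \subset zeros f))%N.
  rewrite /N -sum1_card big_mkcond /=; apply: eq_bigr => f _; rewrite inE.
  have -> : (S \subset zeros f) = [forall x in S, f x == ord0]; last by case: ifP.
  apply/subsetP/forall_inP => H x /H; by rewrite inE.
have count_sum (X : finType) (P : {set X}) (S : X -> {set T}) :
    (\sum_f #|[set x in P | S x \subset zeros f]| = \sum_(x in P) N (S x))%N.
  under [RHS]eq_bigr => x _ do rewrite NE.
  rewrite exchange_big /=; apply: eq_bigr => f _.
  rewrite -sum1_card (eq_bigl (fun x => (x \in P) && (S x \subset zeros f))); last first.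
    by move=> x; rewrite inE.
  by rewrite big_mkcondr; apply: eq_bigr => x _; case: ifP.
have Npow S : (N S * k.+1 ^ #|S| = k.+1 ^ #|T|)%N by exact: card_ffun_const_on.
have sum_bound : (\sum_(a in F) N (B a) <= 4 * (\sum_(x : T) N [set x]) + \sum_(c : C) N (D c))%N.
  have e1 : (\sum_(x : T) N [set x] = \sum_f #|zeros f|)%N.
    rewrite (eq_bigl (fun x => x \in [set: T])); last by move=> x; rewrite inE.
    rewrite -count_sum; apply: eq_bigr => f _; apply: eq_card => x.
    by rewrite !inE /= sub1set inE.
  have e2 : (\sum_(c : C) N (D c) = \sum_f #|[set c | D c \subset zeros f]|)%N.
    rewrite (eq_bigl (fun x => x \in [set: C])); last by move=> x; rewrite inE.
    rewrite -count_sum; apply: eq_bigr => f _; apply: eq_card => x.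
    by rewrite !inE.
  rewrite -count_sum e1 e2 big_distrr -big_split /=.
  by apply: leq_sum => f _; apply: bound.
have K0 : (0 < k.+1 ^ #|T|)%N by rewrite expn_gt0.
rewrite -(leq_pmul2r K0).
(* After scaling by (k+1)^4, pairs weigh at least (k+1)^2, single points (k+1)^3 and quadruples
   1. *)
have c1 : (#|F| * k.+1 ^ 2 * k.+1 ^ #|T| <= (\sum_(a in F) N (B a)) * k.+1 ^ 4)%N.
  rewrite -mulnA -sum_nat_const big_distrl /=; apply: leq_sum => a aF.
  rewrite -(Npow (B a)) mulnCA leq_mul2l -expnD leq_pexp2l ?orbT //.
  by have := B2 a aF; lia.
have c2 : ((\sum_(x : T) N [set x]) * k.+1 = #|T| * k.+1 ^ #|T|)%N.
  rewrite -sum_nat_const big_distrl /=; apply: eq_bigr => x _.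
  by rewrite -(Npow [set x]) cards1.
have c3 : ((\sum_(c : C) N (D c)) * k.+1 ^ 4 = #|C| * k.+1 ^ #|T|)%N.
  rewrite -sum_nat_const big_distrl /=; apply: eq_bigr => c _.
  by rewrite -(Npow (D c)) D4.
apply: (leq_trans c1); apply: (leq_trans (leq_mul sum_bound (leqnn _))).
rewrite (mulnDl _ _ (k.+1 ^ 4)%N) c3 (mulnDl _ #|C|) leq_add2r.
rewrite -!(mulnA 4) leq_mul2l; apply/orP; right.
by rewrite expnS mulnA c2 -mulnA -(mulnA #|T|) [(k.+1 ^ #|T| * _)%N]mulnC.
Qed.

(** * Szemeredi--Trotter for parallel classes of lines *)

Section Directions.
Variables (R : realFieldType) (T I U : finType).
(** The points are (s p, w p), and [c i p] labels the line of slope - m i through p; each direction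
    thus uses at most |U| lines. *)
Variables (s w : T -> R) (m : I -> R) (c : I -> T -> U).
Hypothesis sw_inj : forall p q, s p = s q -> w p = w q -> p = q.
Hypothesis m_inj : injective m.
Hypothesis cE : forall i p q,
  (c i p == c i q) = (w p + m i * s p == w q + m i * s q).

Let src (e : T * I) := e.1.
Let sl (e : T * I) := - m e.2.
Local Notation ht := (height s w src sl).

Let heightE e x : ht e x = w e.1 + m e.2 * s e.1 - m e.2 * x.
Proof. by rewrite /height /sl /src; ring. Qed.

Let height_on e v : (w v == ht e (s v)) = (c e.2 v == c e.2 e.1).
Proof. by rewrite heightE cE eq_sym subr_eq eq_sym. Qed.

Let heights_meet e f x y : ht e x = ht f x -> ht e y = ht f y -> x != y -> e.2 = f.2.
Proof.
rewrite !heightE => ex ey xy; apply: m_inj; apply/eqP; rewrite -subr_eq0.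
have : (m e.2 - m f.2) * (x - y) == 0 by apply/eqP; lra.
by rewrite mulf_eq0 [x - y == 0]subr_eq0 (negPf xy) orbF.
Qed.

Let is_next (e : T * I) q := [/\ c e.2 q = c e.2 e.1, s e.1 < s q &
  forall q', c e.2 q' = c e.2 e.1 -> s e.1 < s q' -> s q <= s q'].

(** The pair (p, i) stands for the segment from p to the next point on its line of direction i; the
    last point of each line has none. *)
Let F := [set e : T * I | [exists q, (c e.2 q == c e.2 e.1) && (s e.1 < s q)]].

Let exists_next : exists nx : T * I -> T, forall e, e \in F -> is_next e (nx e).
Proof.
suff /choice[nx nxP] : forall e, exists q, e \in F -> is_next e q by exists nx.
move=> e; case: (boolP (e \in F)) => [|_]; last by exists e.1.
rewrite inE => /existsP[q0 q0P].
have := @Order.TotalTheory.arg_minP _ _ _ q0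
  (fun q => (c e.2 q == c e.2 e.1) && (s e.1 < s q)) s q0P.
case=> q /andP[/eqP qc sq] qmin; exists q => _; split=> // q' /eqP q'c sq'.
by apply: qmin; rewrite q'c.
Qed.

Let card_next : (#|I| * #|T| <= #|F| + #|I| * #|U|)%N.
Proof.
have -> : (#|I| * #|T| = #|{: T * I}|)%N by rewrite card_prod mulnC.
rewrite -(cardC (mem F)) leq_add2l.
have -> : (#|I| * #|U| = #|{: U * I}|)%N by rewrite card_prod mulnC.
pose g (e : T * I) := (c e.2 e.1, e.2).
rewrite -(card_in_image (f := g)); first exact: max_card.
move=> [p i] [q j]; rewrite !inE /= => /existsPn lp /existsPn lq [+ ij]; rewrite -{j}ij in lq * => /eqP pq.
have sE : s p = s q.
  have := lp q; have := lq p; rewrite /= pq [c i q == _]eq_sym pq /= -!leNgt => h1 h2.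
  by apply/le_anti; rewrite h1 h2.
by rewrite (@sw_inj p q) //; move: pq; rewrite cE sE => /eqP/addIr.
Qed.

Section Next.
Variable nx : T * I -> T.
Hypothesis nxP : forall e, e \in F -> is_next e (nx e).

Let inside e x := (s e.1 < x) && (x < s (nx e)).

Let Cr := [set ef : (T * I) * (T * I) | `[< [/\ ef.1 \in F, ef.2 \in F, ef.1 != ef.2 &
  exists x, [/\ inside ef.1 x, inside ef.2 x & ht ef.1 x = ht ef.2 x]] >]].

Let height_next e : e \in F -> ht e (s (nx e)) = w (nx e).
Proof. by move=> /nxP[/eqP + _ _]; rewrite -height_on => /eqP. Qed.

Let height_start e : ht e (s e.1) = w e.1.
Proof. by rewrite height_src. Qed.

Let same_line e f x : e \in F -> f \in F -> inside e x -> inside f x -> e.2 = f.2 ->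
  ht e x = ht f x -> e = f.
Proof.
move=> eF fF /andP[ex1 ex2] /andP[fx1 fx2] ef exf.
have val : w e.1 + m e.2 * s e.1 = w f.1 + m e.2 * s f.1.
  by move: exf; rewrite !heightE -ef => /addIr.
have cef : c e.2 e.1 = c e.2 f.1 by apply/eqP; rewrite cE val.
have [_ _ emin] := nxP eF; have [_ _ fmin] := nxP fF.
have sE : s e.1 = s f.1.
  apply/le_anti; rewrite !leNgt; apply/andP; split; apply/negP => lt.
    have := fmin e.1; rewrite -ef => /(_ cef lt).
    by rewrite leNgt (lt_trans ex1 fx2).
  have := emin f.1 (esym cef) lt.
  by rewrite leNgt (lt_trans fx1 ex2).
rewrite [e]surjective_pairing [f]surjective_pairing -ef; congr (_, _).
by apply: sw_inj => //; move: val; rewrite sE => /addIr.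
Qed.

Let crossing_dirs e f : (e, f) \in Cr -> e.2 != f.2.
Proof.
rewrite inE => /asboolP[/= eF fF ef [x [ex fx exf]]].
by apply: contraNneq ef => /(same_line eF fF ex fx)/(_ exf) ->.
Qed.

(** A crossing is determined by its two lines: they have different directions, so they meet once,
    and segments of one line have disjoint interiors. *)
Let card_crossings : (#|Cr| <= (#|I| * #|U|) ^ 2)%N.
Proof.
pose l (e : T * I) := (e.2, c e.2 e.1).
pose g (ef : (T * I) * (T * I)) := (l ef.1, l ef.2).
have -> : ((#|I| * #|U|) ^ 2 = #|{: (I * U) * (I * U)}|)%N.
  by rewrite !card_prod mulnn.
rewrite -(card_in_imset (f := g)); first exact: max_card.
move=> [e f] [e' f'] ef ef' [e2 ec f2 fc].
have := crossing_dirs ef; have := crossing_dirs ef'.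
move: ef ef'; rewrite inE => /asboolP[/= eF fF _ [x [ex fx exf]]].
rewrite inE => /asboolP[/= e'F f'F _ [x' [ex' fx' exf']]] d' d.
have lE a b y : a.2 = b.2 -> c a.2 a.1 = c b.2 b.1 -> ht a y = ht b y.
  by move=> ab; rewrite !heightE -ab => /eqP; rewrite cE => /eqP ->.
have xx' : x = x'.
  apply/eqP/negPn/negP => xx'; case/eqP: d.
  apply: heights_meet exf _ xx'.
  by rewrite (lE e e') // (lE f f').
rewrite -xx' in ex' fx'.
by rewrite (same_line eF e'F ex ex' e2 (lE _ _ _ e2 ec))
  (same_line fF f'F fx fx' f2 (lE _ _ _ f2 fc)).
Qed.

Let crossing_endpoints e f v : (e, f) \in Cr ->
  v \in [set e.1; nx e] -> v \notin [set f.1; nx f].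
Proof.
move=> ef ve; apply/negP => vf.
have /negP := crossing_dirs ef; apply; apply/eqP.
move: ef; rewrite inE => /asboolP[/= eF fF _ [x [ex fx exf]]].
have on a : a \in F -> v \in [set a.1; nx a] -> ht a (s v) = w v.
  by move=> aF; rewrite !inE => /orP[] /eqP ->; rewrite ?height_start ?height_next.
apply: (heights_meet exf (y := s v)); first by rewrite !on.
move: ve; rewrite !inE => /orP[] /eqP->; case/andP: ex => h1 h2.
  by rewrite gt_eqF.
by rewrite lt_eqF.
Qed.

(** Deleting the first edge of every crossing inside [V] leaves a plane graph, and the deleted edges
    number at most the crossings. *)
Let plane_subgraph (V : {set T}) :
  (#|[set e in F | [set e.1; nx e] \subset V]| <= 4 * #|V| +
   #|[set ef : {ef | ef \in Cr} |
       [set (val ef).1.1; nx (val ef).1] :|: [set (val ef).2.1; nx (val ef).2] \subset V]|)%N.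
Proof.
set FV := [set e in F | _]; set CV := [set ef | _].
pose bad := [set e in FV | [exists f in FV, (e, f) \in Cr]].
have FVP e : e \in FV -> [/\ e \in F, e.1 \in V & nx e \in V].
  by rewrite inE subUset !sub1set => /andP[-> /andP[-> ->]].
rewrite -(cardsID bad FV) addnC; apply: leq_add.
  apply: (@plane_graph_card _ _ _ s w src nx sl).
  split=> //.
  - by move=> e; rewrite inE => /andP[_ /FVP[]].
  - by move=> e; rewrite inE => /andP[_ /FVP[]].
  - by move=> e; rewrite inE => /andP[_ /FVP[/nxP[]]].
  - by move=> e; rewrite inE => /andP[_ /FVP[/height_next]].
  - move=> e v; rewrite inE => /andP[_ /FVP[eF _ _]] vV /andP[v1 v2] /eqP.
    rewrite height_on => /eqP vc.
    by have [_ _ /(_ v vc v1)] := nxP eF; rewrite leNgt v2.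
  - move=> e f x /setDP[eV eB] /setDP[fV _] ef ex fx exf.
    move: eB; rewrite inE eV /= => /negP; apply; apply/exists_inP; exists f => //.
    have [eF _ _] := FVP e eV; have [fF _ _] := FVP f fV.
    by rewrite inE; apply/asboolP; split=> //; exists x.
apply: (@leq_trans #|[set (val ef).1 | ef in CV]|); last exact: leq_imset_card.
apply/subset_leq_card/subsetP => e; rewrite inE => /andP[_].
rewrite inE => /andP[eV /exists_inP[f fV ef]].
apply/imsetP; exists (exist _ (e, f) ef) => //.
by rewrite inE !subUset !sub1set /=; have [_ -> ->] := FVP e eV; have [_ -> ->] := FVP f fV.
Qed.

Lemma next_count k :
  (#|F| * k.+1 ^ 2 <= 4 * #|T| * k.+1 ^ 3 + (#|I| * #|U|) ^ 2)%N.
Proof.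
apply: leq_trans (leq_add (leqnn _) card_crossings).
have -> : #|Cr| = #|{: {ef | ef \in Cr}}| by rewrite card_sig; apply: eq_card.
apply: leq_sampling plane_subgraph => [e eF|[[e f] ef]] /=.
  by rewrite cards2; case: (_ != _).
have [eF fF] : e \in F /\ f \in F by move: (ef); rewrite inE => /asboolP[].
have two a : a \in F -> #|[set a.1; nx a]| = 2.
  move=> /nxP[_ lt _]; rewrite cards2; case: eqVneq => // E.
  by move: lt; rewrite E ltxx.
rewrite cardsU disjoint_setI0 ?cards0 ?subn0 ?two //.
by rewrite disjoint_subset; apply/subsetP => v /(crossing_endpoints ef).
Qed.

End Next.

Lemma directions_count k :
  (#|I| * #|T| * k.+1 ^ 2 <=
   4 * #|T| * k.+1 ^ 3 + (#|I| * #|U|) ^ 2 + #|I| * #|U| * k.+1 ^ 2)%N.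
Proof.
have [nx nxP] := exists_next.
apply: leq_trans (leq_mul card_next (leqnn _)) _.
by rewrite mulnDl leq_add2r; apply: next_count nxP _.
Qed.

Lemma projections_lower_bound : (16 <= #|I|)%N -> (2 * #|U| <= #|T|)%N ->
  (#|I| * #|T| <= 2 ^ 12 * #|U| ^ 2)%N.
Proof.
move=> M16 un.
(* With about |I| / 16 colours the cubic term is at most a quarter of the left side, and 2 |U| <=
   |T| makes the last term at most half of it. *)
have := directions_count (#|I| %/ 16).-1.
have k0 : (0 < #|I| %/ 16)%N by rewrite divn_gt0.
rewrite prednK //.
have k1 : (16 * (#|I| %/ 16) <= #|I|)%N by rewrite mulnC leq_trunc_div.
have k2 : (#|I| <= 32 * (#|I| %/ 16))%N.
  have := ltn_ceil #|I| (isT : 0 < 16)%N; lia.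
move: (#|I| %/ 16)%N k0 k1 k2 => k k0 k1 k2 h.
move: #|I| #|T| #|U| M16 un k1 k2 h => M n u M16 un k1 k2 h.
have h2 : (n * k ^ 2 * (16 * k) <= n * k ^ 2 * M)%N by rewrite leq_mul2l k1 orbT.
have h3 : (M * k ^ 2 * (2 * u) <= M * k ^ 2 * n)%N by rewrite leq_mul2l un orbT.
have h4 : (M * n * k ^ 2 <= 4 * (M * u) ^ 2)%N by nia.
have h5 : (M ^ 2 <= 1024 * k ^ 2)%N by nia.
have h6 : (M ^ 2 * (M * n) <= M ^ 2 * (2 ^ 12 * u ^ 2))%N.
  apply: (@leq_trans (1024 * k ^ 2 * (M * n))); first by rewrite leq_mul2r h5 orbT.
  lia.
by move: h6; rewrite leq_pmul2l // expn_gt0 (leq_trans _ M16).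
Qed.

End Directions.

(** * The cross-ratio expander *)

(** Divided differences at the three roots give [c2] = 0, then [c1] = 0, then [c0] = 0. *)
Lemma quadratic_three_roots (F : fieldType) (c0 c1 c2 z1 z2 z3 : F) :
  z1 != z2 -> z2 != z3 -> z1 != z3 ->
  c2 * z1 ^+ 2 + c1 * z1 + c0 = 0 -> c2 * z2 ^+ 2 + c1 * z2 + c0 = 0 ->
  c2 * z3 ^+ 2 + c1 * z3 + c0 = 0 -> c0 = 0 /\ c1 = 0.
Proof.
move=> z12 z23 z13 e1 e2 e3.
have e12 : c2 * (z1 + z2) + c1 = 0.
  apply: (mulfI (x := z1 - z2)); first by rewrite subr_eq0.
  rewrite mulr0; transitivity (c2 * z1 ^+ 2 + c1 * z1 + c0 - (c2 * z2 ^+ 2 + c1 * z2 + c0)).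
    by ring.
  by rewrite e1 e2 subrr.
have e13 : c2 * (z1 + z3) + c1 = 0.
  apply: (mulfI (x := z1 - z3)); first by rewrite subr_eq0.
  rewrite mulr0; transitivity (c2 * z1 ^+ 2 + c1 * z1 + c0 - (c2 * z3 ^+ 2 + c1 * z3 + c0)).
    by ring.
  by rewrite e1 e3 subrr.
have c20 : c2 = 0.
  apply: (mulIf (x := z2 - z3)); first by rewrite subr_eq0.
  rewrite mul0r; transitivity (c2 * (z1 + z2) + c1 - (c2 * (z1 + z3) + c1)); first by ring.
  by rewrite e12 e13 subrr.
move: e12 e1; rewrite c20 !mul0r !add0r => -> /eqP.
by rewrite mul0r add0r => /eqP.
Qed.

(* The cross-ratio equation says [w = (alpha z + beta) / (gamma z + zeta)] with
   [alpha = r b - a], [beta = r - 1], [gamma = (1 - r) a b], [zeta = b - r a];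
   three common values of z force the two Moebius maps to coincide, and the
   parameters (a, b) are recovered from the coefficients. *)
Lemma cross_ratio_rigidity (F : realFieldType) (r a b a' b' : F) (z w : 'I_3 -> F) :
  1 < r -> 0 <= a -> a < b -> 0 <= a' -> a' < b' ->
  injective z -> (forall k, 0 <= z k) ->
  (forall k, (1 + b * w k) * (1 + a * z k) = r * ((1 + b * z k) * (1 + a * w k))) ->
  (forall k, (1 + b' * w k) * (1 + a' * z k) = r * ((1 + b' * z k) * (1 + a' * w k))) ->
  a = a'.
Proof.
move=> r1 a0 ab a'0 ab' zinj z0 eq1 eq2.
pose c0 := (r - 1) * ((b' - r * a') - (b - r * a)).
pose c1 := (r * b - a) * (b' - r * a') + (r - 1) * ((1 - r) * (a' * b'))
  - (r * b' - a') * (b - r * a) - (r - 1) * ((1 - r) * (a * b)).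
pose c2 := (r * b - a) * ((1 - r) * (a' * b')) - (r * b' - a') * ((1 - r) * (a * b)).
have Q k : c2 * z k ^+ 2 + c1 * z k + c0 = 0.
  have e1 : w k * ((1 - r) * (a * b) * z k + (b - r * a)) = (r * b - a) * z k + (r - 1).
    by have := eq1 k; move=> e; apply/eqP; rewrite -subr_eq0; apply/eqP; move/eqP: e;
      rewrite -subr_eq0 => /eqP e; rewrite -[RHS]e; ring.
  have e2 : w k * ((1 - r) * (a' * b') * z k + (b' - r * a')) = (r * b' - a') * z k + (r - 1).
    by have := eq2 k; move=> e; apply/eqP; rewrite -subr_eq0; apply/eqP; move/eqP: e;
      rewrite -subr_eq0 => /eqP e; rewrite -[RHS]e; ring.
  transitivity (((r * b - a) * z k + (r - 1)) * ((1 - r) * (a' * b') * z k + (b' - r * a'))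
     - ((r * b' - a') * z k + (r - 1)) * ((1 - r) * (a * b) * z k + (b - r * a))).
    by rewrite /c0 /c1 /c2; ring.
  by rewrite -e1 -e2; ring.
have [||| c00 c10] := quadratic_three_roots _ _ _ (Q (inord 0)) (Q (inord 1)) (Q (inord 2)).
- by rewrite (inj_eq zinj) -val_eqE /= !inordK.
- by rewrite (inj_eq zinj) -val_eqE /= !inordK.
- by rewrite (inj_eq zinj) -val_eqE /= !inordK.
have zeta : b' - r * a' = b - r * a.
  move/eqP: c00; rewrite /c0 mulf_eq0 subr_eq0 gt_eqF //= subr_eq0 => /eqP //.
have b'E : b' = b + r * (a' - a) by rewrite mulrBr; lra.
(* Once [c0] = 0 has been used to eliminate b', the coefficient [c1] factors, and a' - a is the only
   factor that can vanish. *)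
have : (r - 1) * (a' - a) * (r * ((b - a) + (b' - a'))) = 0.
  by rewrite -[RHS]oppr0 -c10 /c1 b'E; ring.
move/eqP; rewrite !mulf_eq0 !subr_eq0 gt_eqF //= => /orP[/eqP->//|].
by rewrite (gt_eqF (lt_trans ltr01 r1)) /= gt_eqF // addr_gt0 // subr_gt0.
Qed.

(* [p i j + d k l] with [d k l <= d i j] stays in the half-open interval from
   [p i j] to its successor, so it determines (i, j) and the value [d k l]; at
   least half of the [n ^ 4] quadruples satisfy the constraint. *)
Lemma lex_chain_count (F : realDomainType) (n mu : nat) (d p : nat -> nat -> F)
    (E : {fset F}) :
  (forall i j, (i < n)%N -> (j < n)%N -> 0 < d i j) ->
  (forall i j, (i < n)%N -> (j < n)%N -> p i j.+1 = p i j + d i j) ->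
  (forall i, (i.+1 < n)%N -> p i n = p i.+1 0) ->
  (forall i j k l, (i < n)%N -> (j < n)%N -> (k < n)%N -> (l < n)%N ->
     p i j + d k l \in E) ->
  (forall v, #|[set e : 'I_n * 'I_n | d e.1 e.2 == v]| <= mu)%N ->
  (n ^ 4 <= 2 * mu * #|` E|)%N.
Proof.
move=> d0 pS pn pE fib.
pose I2 := ('I_n * 'I_n)%type; pose dl (e : I2) := d e.1 e.2.
pose S := [set ef : I2 * I2 | dl ef.2 <= dl ef.1].
have half : (n ^ 4 <= 2 * #|S|)%N.
  have -> : (n ^ 4 = #|{: I2 * I2}|)%N by rewrite !card_prod card_ord; lia.
  pose sw (ef : I2 * I2) := (ef.2, ef.1).
  have swI : injective sw by move=> [? ?] [? ?] [-> ->].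
  rewrite mul2n -addnn -{2}(card_imset _ swI) -cardsT.
  apply: leq_trans (leq_card_setU _ _).1.
  apply/subset_leq_card/subsetP => -[e f] _; rewrite inE.
  case: (leP (dl f) (dl e)) => [le|/ltW le]; first by rewrite inE /= le.
  by apply/orP; right; apply/imsetP; exists (f, e); rewrite // inE.
have p_mono i j j' : (i < n)%N -> (j <= j')%N -> (j' <= n)%N -> p i j <= p i j'.
  move=> iln; elim: j' => [|j' IH]; first by rewrite leqn0 => /eqP->.
  rewrite leq_eqVlt => /orP[/eqP->//|jj'] j'n.
  by rewrite (le_trans (IH jj' (ltnW j'n))) // pS // lerDl ltW // d0.
have p_row i i' : (i <= i')%N -> (i' < n)%N -> p i 0 <= p i' 0.
  elim: i' => [|i' IH]; first by rewrite leqn0 => /eqP->.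
  rewrite leq_eqVlt => /orP[/eqP->//|ii'] i'n.
  by rewrite (le_trans (IH ii' (ltnW i'n))) // -pn // p_mono // ltnW.
have p_lex i j i' j' : (i < n)%N -> (j < n)%N -> (i' < n)%N -> (j' < n)%N ->
    (i < i')%N || (i == i') && (j < j')%N -> p i j.+1 <= p i' j'.
  move=> iln jn i'n j'n /orP[ii'|/andP[/eqP<- jj']]; last by rewrite p_mono // ltnW.
  apply: (@le_trans _ _ (p i n)); first by rewrite p_mono.
  rewrite pn ?(leq_ltn_trans ii') //.
  by apply: (@le_trans _ _ (p i' 0)); [rewrite p_row|rewrite p_mono // ltnW].
have p_sep (e e' : I2) v v' : 0 < v -> 0 < v' -> v <= dl e -> v' <= dl e' ->
    p e.1 e.2 + v = p e'.1 e'.2 + v' -> e = e'.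
  move: e e' v v' => [i j] [i' j'] v v' /=.
  have main (a b a' b' : 'I_n) u u' : 0 < u' -> u <= d a b ->
      p a b + u = p a' b' + u' -> ~~ ((a < a')%N || (a == a' :> nat) && (b < b')%N).
    move=> u'0 uab E1; apply/negP => /p_lex H.
    suff : p a b + u < p a' b' + u' by rewrite E1 ltxx.
    apply: (@le_lt_trans _ _ (p a' b')); last by rewrite ltrDl.
    by apply: le_trans (H _ _ _ _) => //; rewrite pS // lerD2l.
  move=> v0 v'0 vd v'd E1.
  have := main _ _ _ _ _ _ v'0 vd E1; have := main _ _ _ _ _ _ v0 v'd (esym E1).
  rewrite !negb_or -!leqNgt => /andP[ii jj] /andP[ii' jj'].
  have iE : i = i' by apply/val_inj/eqP; rewrite eqn_leq ii ii'.
  move: jj jj'; rewrite iE !eqxx /= -!leqNgt => jj jj'.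
  by congr (_, _); apply/val_inj/eqP; rewrite eqn_leq jj jj'.
suff : (#|S| <= mu * #|` E|)%N by move=> h; apply: leq_trans half _; rewrite -mulnA leq_mul2l h.
pose val_ (ef : I2 * I2) := p ef.1.1 ef.1.2 + dl ef.2.
have valE ef : val_ ef \in E by apply: pE.
pose h (ef : I2 * I2) : E := [` valE ef]%fset.
have dl0 e : 0 < dl e by apply: d0.
(* [S] is split by the value of p + d. On each class (i, j) is constant, so the second pair runs
   through one level set of d, of size at most [mu]. *)
rewrite -sum1_card (partition_big h predT) //= mulnC cardfE -sum_nat_const.
apply: leq_sum => y _; rewrite sum1dep_card.
set A := [set x | _].
case: (set_0Vmem A) => [->|[[e f]]]; first by rewrite cards0.
rewrite !inE /= => /andP[Sef /eqP hy].
apply: leq_trans (fib (dl f)).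
have <- : #|[set ef.2 | ef in A]| = #|A|.
  apply: card_in_imset => -[e1 f1] [e2 f2].
  rewrite !inE /= => /andP[S1 /eqP h1] /andP[S2 /eqP h2] f12.
  rewrite f12 in S1 h1 *; congr (_, _).
  by apply: (p_sep _ _ (dl f2) (dl f2)) => //; move: h1; rewrite -h2 => /(congr1 val).
apply/subset_leq_card/subsetP => _ /imsetP[[e' f'] + ->].
rewrite !inE /= => /andP[Sef' /eqP]; rewrite -hy => /(congr1 val) /= E1.
have ee : e' = e by apply: (p_sep _ _ (dl f') (dl f)).
by move: E1; rewrite /val_ /= ee => /addrI E2; apply/eqP.
Qed.

Section Expander.
Variables (R : realType) (n : nat) (x : nat -> R).
Hypothesis x0 : 0 <= x 0%N.
Hypothesis x_lt : forall i j, (i < j)%N -> (j <= n)%N -> x i < x j.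

Let g i j := ln (1 + x i * x j).
Let d k l := g k.+1 l.+1 + g k l - g k.+1 l - g k l.+1.

Let x_ge0 i : (i <= n)%N -> 0 <= x i.
Proof.
case: i => // i iln; apply: le_trans x0 _; exact/ltW/x_lt.
Qed.

Let x_inj i j : (i <= n)%N -> (j <= n)%N -> x i = x j -> i = j.
Proof.
move=> iln jn E; case: (ltngtP i j) => // /x_lt; last by move=> /(_ iln); rewrite E ltxx.
by move=> /(_ jn); rewrite E ltxx.
Qed.

Let pos i j : (i <= n)%N -> (j <= n)%N -> 0 < 1 + x i * x j.
Proof. by move=> iln jn; rewrite ltr_pwDl // mulr_ge0 ?x_ge0. Qed.

Let dE k l : (k < n)%N -> (l < n)%N ->
  d k l = ln ((1 + x k.+1 * x l.+1) * (1 + x k * x l))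
        - ln ((1 + x k.+1 * x l) * (1 + x k * x l.+1)).
Proof.
move=> kn ln'; have kn' := ltnW kn; have ln'' := ltnW ln'.
rewrite /d /g !lnM ?posrE ?pos //; ring.
Qed.

Let d_gt0 k l : (k < n)%N -> (l < n)%N -> 0 < d k l.
Proof.
move=> kn ln'; have kn' := ltnW kn; have ln'' := ltnW ln'.
rewrite dE // subr_gt0 ltr_ln ?posrE ?mulr_gt0 ?pos //.
have hk := x_lt (ltnSn k) kn; have hl := x_lt (ltnSn l) ln'.
rewrite -subr_gt0.
have -> : (1 + x k.+1 * x l.+1) * (1 + x k * x l) - (1 + x k.+1 * x l) * (1 + x k * x l.+1)
  = (x k.+1 - x k) * (x l.+1 - x l) by ring.
by rewrite mulr_gt0 // subr_gt0.
Qed.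

(** By rigidity two rows of a level set share at most two columns. With m the size of the level set,
    Cauchy--Schwarz gives m^2 <= n (m + 2 n^2). *)
Let d_fiber v : (#|[set e : 'I_n * 'I_n | d e.1 e.2 == v]| ^ 2 <= 4 * n ^ 3)%N.
Proof.
case: (set_0Vmem [set e : 'I_n * 'I_n | d e.1 e.2 == v]) => [->|[[i0 j0]]].
  by rewrite cards0.
rewrite inE /= => /eqP dv.
(* Positivity of v makes the cross-ratio [expR v] exceed 1, as rigidity requires. *)
have v0 : 0 < v by rewrite -dv d_gt0.
have n0 : (0 < n)%N by apply: leq_ltn_trans (ltn_ord i0).
pose B (i : 'I_n) := [set j : 'I_n | d i j == v].
have -> : #|[set e : 'I_n * 'I_n | d e.1 e.2 == v]| = (\sum_i #|B i|)%N.
  rewrite -sum1_card (eq_bigl (fun e => predT e.1 && (e.2 \in B e.1))); last first.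
    by move=> e; rewrite !inE.
  rewrite -(pair_big_dep predT (fun i j => j \in B i) (fun _ _ => 1%N)) /=.
  by apply: eq_bigr => i _; rewrite sum1_card.
have BB i i' : i != i' -> (#|B i :&: B i'| <= 2)%N.
  move=> ii'; rewrite leqNgt; apply/negP => /card_gt2P[j1 [j2 [j3 [[J1 J2 J3] [j12 j23 j31]]]]].
  pose j (k : 'I_3) := nth j1 [:: j1; j2; j3] k.
  have jB k : j k \in B i :&: B i' by case: k => -[|[|[|//]]].
  have juniq : uniq [:: j1; j2; j3] by rewrite /= !inE negb_or j12 j23 eq_sym j31.
  have eqj (a : 'I_n) k : d a (j k) = v ->
      (1 + x a.+1 * x (j k).+1) * (1 + x a * x (j k)) =
      expR v * ((1 + x a.+1 * x (j k)) * (1 + x a * x (j k).+1)).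
    rewrite dE // => /eqP; rewrite subr_eq => /eqP E.
    have P1 := pos (ltn_ord a) (ltn_ord (j k)).
    have P2 := pos (ltnW (ltn_ord a)) (ltnW (ltn_ord (j k))).
    have P3 := pos (ltn_ord a) (ltnW (ltn_ord (j k))).
    have P4 := pos (ltnW (ltn_ord a)) (ltn_ord (j k)).
    by rewrite -[LHS]lnK ?posrE ?mulr_gt0 // E expRD lnK // posrE mulr_gt0.
  suff : x i = x i'.
    by move=> /x_inj H; move/eqP: ii'; apply; apply/val_inj/H; apply/ltnW/ltn_ord.
  apply: (@cross_ratio_rigidity _ (expR v) (x i) (x i.+1) (x i') (x i'.+1)
    (fun k => x (j k)) (fun k => x (j k).+1)).
  - by rewrite expR_gt1.
  - exact/x_ge0/ltnW.
  - exact: x_lt.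
  - exact/x_ge0/ltnW.
  - exact: x_lt.
  - move=> k k' /x_inj E; apply/val_inj/eqP; rewrite -(@nth_uniq _ j1 [:: j1; j2; j3] k k' (ltn_ord k) (ltn_ord k') juniq).
    by apply/eqP/val_inj/E; apply/ltnW/ltn_ord.
  - by move=> k; apply/x_ge0/ltnW.
  - by move=> k; apply: eqj; have := jB k; rewrite !inE => /andP[/eqP].
  - by move=> k; apply: eqj; have := jB k; rewrite !inE => /andP[_ /eqP].
have := leq_sqr_sum_card B; set m := (\sum_i #|B i|)%N; rewrite card_ord => h.
have : (m ^ 2 <= n * (m + 2 * n ^ 2))%N.
  apply: leq_trans h _; rewrite leq_mul2l; apply/orP; right.
  apply: (@leq_trans (\sum_(i < n) (#|B i| + \sum_(j < n) 2))).
    apply: leq_sum => i _; rewrite (bigD1 i) //= setIid leq_add2l.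
    rewrite [leqRHS](bigD1 i) //= (leq_trans _ (leq_addl _ _)) //.
    by apply: leq_sum => j ji; apply: BB; rewrite eq_sym.
  by rewrite big_split /= leq_add2l !sum_nat_const card_ord; lia.
case: (leqP m (2 * n)) => mn H.
  apply: (@leq_trans ((2 * n) ^ 2)); first by rewrite leq_sqr.
  by rewrite expnMn leq_mul2l /= leq_pexp2l.
have : (2 * n * m <= m * m)%N by rewrite leq_mul2r (ltnW mn) orbT.
lia.
Qed.

Variables (G : {fset R}) (t : nat -> R).
Hypothesis gG : forall i j, (i <= n)%N -> (j <= n)%N -> g i j + t i + t j \in G.

Lemma cross_ratio_expander :
  (n ^ 5 <= 16 * #|` sumset (nsumset 4 G) (oppset (nsumset 4 G))| ^ 2)%N.
Proof.
set E := sumset _ _.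
(* The shifts t cancel in d, but in p they leave t n - t 0; adding this constant makes p + d a
   signed sum of eight elements of [G]. *)
pose p i j := g i n - g i j + g i.+1 j - g i.+1 0 + (t n - t 0).
have sum4 a b c e : a \in G -> b \in G -> c \in G -> e \in G ->
    a + b + c + e \in nsumset 4 G.
  move=> aG bG cG eG; rewrite !nsumsetS -!addrA.
  by do 3!(apply: mem_sumset => //); rewrite sumset0.
pose mu := \max_(e : 'I_n * 'I_n)
  #|[set e' : 'I_n * 'I_n | d e'.1 e'.2 == d e.1 e.2]|.
have mu2 : (mu ^ 2 <= 4 * n ^ 3)%N.
  case: (pickP {: 'I_n * 'I_n}) => [e0 _|none].
    have [e E0] := @bigop.eq_bigmax _ (fun e : 'I_n * 'I_n =>
      #|[set e' : 'I_n * 'I_n | d e'.1 e'.2 == d e.1 e.2]|) (introT card_gt0P (ex_intro _ e0 isT)).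
    by rewrite /mu E0 d_fiber.
  by rewrite /mu big_pred0.
have : (n ^ 4 <= 2 * mu * #|` E|)%N.
  apply: (@lex_chain_count _ n mu d p) => //.
  - by move=> i j _ _; rewrite /p /d; ring.
  - by move=> i iln; rewrite /p; ring.
  - move=> i j k l iln jn kn ln'.
    pose y i j := g i j + t i + t j.
    have -> : p i j + d k l = (y i n + y i.+1 j + y k.+1 l.+1 + y k l) -
        (y i j + y i.+1 0 + y k.+1 l + y k l.+1) by rewrite /p /d /y; ring.
    by apply: mem_sumset; rewrite ?mem_oppset ?opprK; apply: sum4;
      apply: gG; rewrite // ltnW.
  - move=> v.
    case: (set_0Vmem [set e : 'I_n * 'I_n | d e.1 e.2 == v]) => [->|[e]].
      by rewrite cards0.
    rewrite inE => /eqP <-.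
    exact: (@leq_bigmax _ (fun e : 'I_n * 'I_n =>
      #|[set e' : 'I_n * 'I_n | d e'.1 e'.2 == d e.1 e.2]|)).
move: #|` E| mu mu2 => T mu mu2 h.
case: (posnP n) => [->|n0]; first by rewrite exp0n.
have h2 : (n ^ 4 * n ^ 4 <= (2 * mu * T) * (2 * mu * T))%N by exact: leq_mul.
have h3 : (4 * T ^ 2 * mu ^ 2 <= 4 * T ^ 2 * (4 * n ^ 3))%N by rewrite leq_mul2l mu2 orbT.
have h4 : (n ^ 3 * n ^ 5 <= n ^ 3 * (16 * T ^ 2))%N by lia.
by move: h4; rewrite leq_pmul2l // expn_gt0 n0.
Qed.

End Expander.

(** * Dot products *)

(** With K = u / t the bound reads 2^8 u^56 / t^55; denominators are cleared. *)
Lemma doubling_constant_nat (F : realFieldType) (T u t : nat) : (0 < t)%N ->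
  T%:R <= (2%:R * (u%:R / t%:R) ^+ 7) ^+ 8 * t%:R :> F ->
  (T * t ^ 55 <= 2 ^ 8 * u ^ 56)%N.
Proof.
move=> t0 h.
have tR : 0 < t%:R :> F by rewrite ltr0n.
have t55 : 0 < t%:R ^+ 55 :> F by rewrite exprn_gt0.
rewrite -(ler_nat F) natrM natrX [leRHS]natrM !natrX.
rewrite exprMn -exprM expr_div_n -(ler_pM2r t55) in h; apply: le_trans h _.
have -> : t%:R ^+ (7 * 8) = t%:R * t%:R ^+ 55 :> F by rewrite -exprS.
move: (t%:R ^+ 55) t55 (2%:R ^+ 8) => x /lt0r_neq0 x0 c.
have {}tR := lt0r_neq0 tR; move: (t%:R) tR => y y0.
have -> : c * (u%:R ^+ (7 * 8) / (y * x)) * y * x = c * u%:R ^+ (7 * 8).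
  by move: (u%:R ^+ _) => z; field; rewrite x0 y0.
by [].
Qed.

Lemma sorted_enumeration (F : realDomainType) (I : finType) (m : I -> F) (X : {set I}) (i0 : I) :
  injective m -> exists e : nat -> I,
    (forall k, (k < #|X|)%N -> e k \in X) /\
    (forall k l, (k < l)%N -> (l < #|X|)%N -> m (e k) < m (e l)).
Proof.
move=> minj.
pose s := sort (relpre m <=%O) (enum X).
have ss : size s = #|X| by rewrite size_sort -cardE.
have sm : sorted <%O [seq m i | i <- s].
  by rewrite -sort_map sort_lt_sorted map_inj_uniq // enum_uniq.
exists (nth i0 s); split=> [k kX|k l kl lX].
  by rewrite -mem_enum -(mem_sort (relpre m <=%O)) mem_nth ?ss.
rewrite -!(nth_map _ (m i0)) ?ss ?(ltn_trans kl) //.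
by rewrite lt_sorted_ltn_nth // inE size_map ss ?(ltn_trans kl).
Qed.

(** * Two estimates for equal fibres over distinct slopes *)

Section Fibers.
Variables (R : realType) (I : finType) (t : nat) (m : I -> R) (a : I -> 'I_t -> R).
Variable L : {fset R}.
Hypothesis t_gt0 : (0 < t)%N.
Hypothesis m_inj : injective m.
Hypothesis m_ge0 : forall i, 0 <= m i.
Hypothesis a_inj : forall i, injective (a i).
Hypothesis a_gt0 : forall i k, 0 < a i k.
Hypothesis aL : forall i j k l, a i k * a j l * (1 + m i * m j) \in L.

Let k0 := Ordinal t_gt0.

Let mm_gt0 i j : 0 < 1 + m i * m j.
Proof. by rewrite ltr_pwDl // mulr_ge0. Qed.

Lemma fiber_card_le (i : I) : (t <= #|` L|)%N.
Proof.
rewrite cardfE -[t in (t <= _)%N]card_ord.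
apply: (@leq_card _ _ (fun k : 'I_t => [` aL i i k0 k]%fset)).
move=> k l /(congr1 val) /= E; apply: (@a_inj i).
by move: E => /(mulIf (lt0r_neq0 (mm_gt0 i i)))/(mulfI (lt0r_neq0 (a_gt0 i k0))).
Qed.

(** The point a(1, m) is drawn at (m a, a). Its line of direction i is labelled by its dot product
    with a fixed point of slope m_i, so [L] supplies the labels. *)
Lemma directions_le : (16 <= #|I|)%N -> (2 * #|` L| <= #|I| * t)%N ->
  (#|I| * (#|I| * t) <= 2 ^ 12 * #|` L| ^ 2)%N.
Proof.
pose s (p : I * 'I_t) := m p.1 * a p.1 p.2.
pose w (p : I * 'I_t) := a p.1 p.2.
pose c i (p : I * 'I_t) : L := [` aL i p.1 k0 p.2]%fset.
have -> : (#|I| * t = #|{: I * 'I_t}|)%N by rewrite card_prod card_ord.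
rewrite cardfE; apply: (@projections_lower_bound _ _ _ _ s w m c) => //.
  move=> [i k] [j l]; rewrite /s /w /= => + akl; rewrite akl.
  move=> /(mulIf (lt0r_neq0 (a_gt0 j l))) /m_inj ij.
  by move: akl; rewrite ij => /a_inj ->.
move=> i p q; rewrite -val_eqE /= /w /s.
have E r : a i k0 * a r.1 r.2 * (1 + m i * m r.1)
   = a i k0 * (a r.1 r.2 + m i * (m r.1 * a r.1 r.2)) by ring.
by rewrite !E (inj_eq (mulfI (lt0r_neq0 (a_gt0 i k0)))).
Qed.

(** After taking logarithms, |I| t <= 2 u |X| comes from the structured subfamily, |X|^5 <= 512 T^2
    from the expander, and T t^55 <= 2^8 u^56 from the doubling bound. Multiplying them eliminates
    |X| and T. *)
Lemma fibers_doubling : (0 < #|I|)%N ->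
  ((#|I| * t) ^ 5 * t ^ 110 <= 2 ^ 30 * #|` L| ^ 117)%N.
Proof.
move=> I0; have /card_gt0P[i0 _] := I0.
pose A i := [fset ln (a i k) | k in 'I_t]%fset.
pose g i j := ln (1 + m i * m j).
pose L' := [fset ln l | l in L]%fset.
have At i : #|` A i| = t.
  rewrite card_in_imfset /= -?cardE ?card_ord // => k l _ _ /ln_inj.
  by rewrite !posrE => /(_ (a_gt0 i k) (a_gt0 i l)) /a_inj.
have gL i j x y : x \in A i -> y \in A j -> x + y + g i j \in L'.
  move=> /imfsetP[k _ ->] /imfsetP[l _ ->].
  rewrite -lnM ?posrE // -lnM ?posrE ?mulr_gt0 //.
  by apply/imfsetP; exists (a i k * a j l * (1 + m i * m j)).
have L'L : (#|` L'| <= #|` L|)%N by apply: leq_imfset_card.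
have [X [s [G [XI gG Gc]]]] := structured_subfamily R t_gt0 I0 At gL.
have [e [eX elt]] := sorted_enumeration X i0 m_inj.
set T := #|` sumset (nsumset 4 G) _| in Gc.
have X0 : (0 < #|X|)%N.
  rewrite lt0n; apply: contraTneq XI => ->; rewrite muln0 leqn0 muln_eq0 negb_or.
  by rewrite -!lt0n I0.
(* The expander takes slopes indexed from 0 to n inclusive, hence n = |X| - 1. *)
have T5 : (#|X|.-1 ^ 5 <= 16 * T ^ 2)%N.
  apply: (@cross_ratio_expander _ #|X|.-1 (m \o e) _ _ G (s \o e)) => //=.
    by move=> k l kl lX; apply: elt => //; rewrite -(prednK X0).
  by move=> k l kX lX; apply: gG; apply: eX; rewrite -(prednK X0).
have T0 : (0 < T)%N.
  have gX : g (e 0) (e 0) + s (e 0) + s (e 0) \in G by apply: gG; apply: eX.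
  rewrite cardfs_gt0; apply/fset0Pn; exists 0.
  set y := _ + _ + _ in gX.
  have y4 : y + (y + (y + (y + 0))) \in nsumset 4 G.
    by rewrite !nsumsetS; do 4!(apply: mem_sumset => //); rewrite fset11.
  by rewrite -(subrr (y + (y + (y + (y + 0))))) mem_sumset // mem_oppset opprK.
(* |X| <= 2 (|X| - 1) costs 2^5 when |X| >= 2; a single slope is covered by T > 0. *)
have X5 : (#|X| ^ 5 <= 512 * T ^ 2)%N.
  have [X1|X1] := leqP #|X| 1.
    apply: (@leq_trans (1 ^ 5)); first by rewrite leq_exp2r.
    by rewrite exp1n muln_gt0 expn_gt0 T0.
  apply: (@leq_trans ((2 * #|X|.-1) ^ 5)); first by rewrite leq_exp2r //; lia.
  by rewrite expnMn; lia.
have TL : (T * t ^ 55 <= 2 ^ 8 * #|` L| ^ 56)%N.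
  apply: (@leq_trans (2 ^ 8 * #|` L'| ^ 56)); last by rewrite leq_mul2l leq_exp2r // L'L orbT.
  exact: doubling_constant_nat Gc.
apply: (@leq_trans ((2 * #|` L| * #|X|) ^ 5 * t ^ 110)).
  rewrite leq_mul2r leq_exp2r // (leq_trans XI) ?orbT // leq_mul2r leq_mul2l L'L.
  by rewrite !orbT.
rewrite !expnMn.
apply: (@leq_trans (2 ^ 5 * #|` L| ^ 5 * (2 ^ 9 * T ^ 2) * t ^ 110)).
  by rewrite leq_mul2r leq_mul2l X5 !orbT.
have -> : (2 ^ 5 * #|` L| ^ 5 * (2 ^ 9 * T ^ 2) * t ^ 110
    = 2 ^ 14 * #|` L| ^ 5 * (T * t ^ 55) ^ 2)%N.
  by rewrite expnMn -expnM (_ : 14 = 5 + 9)%N // expnD; lia.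
apply: (@leq_trans (2 ^ 14 * #|` L| ^ 5 * (2 ^ 8 * #|` L| ^ 56) ^ 2)).
  by rewrite leq_mul2l leq_sqr TL orbT.
rewrite expnMn -!expnM mulnACA -!expnD.
by rewrite (_ : 14 + 8 * 2 = 30)%N // (_ : 5 + 56 * 2 = 117)%N.
Qed.

End Fibers.

(** * Combining the exponents *)

Lemma leq_exp_of_linear (b N u : nat) : (0 < b)%N -> (0 < u)%N -> (N <= b ^ 4 * u)%N ->
  (N ^ 225 <= b ^ 1350 * u ^ 337)%N.
Proof.
move=> b0 u0 h; apply: (@leq_trans ((b ^ 4 * u) ^ 225)); first by rewrite leq_exp2r.
by rewrite expnMn -expnM leq_mul // leq_pexp2l.
Qed.

(** Write N = M t. The first bound gives N^2 <= b^12 u^2 t; its 110th power supplies t^110, which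
    the second bound absorbs. The base b, later 2, keeps the large powers symbolic. *)
Lemma leq_exp_of_doubling (b M t u : nat) :
  (M * (M * t) <= b ^ 12 * u ^ 2)%N ->
  ((M * t) ^ 5 * t ^ 110 <= b ^ 30 * u ^ 117)%N ->
  ((M * t) ^ 225 <= b ^ 1350 * u ^ 337)%N.
Proof.
move=> dir dou.
have sq : ((M * t) ^ 2 <= b ^ 12 * u ^ 2 * t)%N.
  by rewrite -mulnn -mulnA [(t * _)%N]mulnC mulnA leq_mul2r dir orbT.
have sq110 : ((M * t) ^ 220 <= b ^ 1320 * u ^ 220 * t ^ 110)%N.
  rewrite (_ : 220 = 2 * 110)%N // (_ : 1320 = 12 * 110)%N // !expnM -!expnMn.
  by rewrite leq_exp2r.
rewrite (_ : 225 = 5 + 220)%N // expnD.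
apply: leq_trans (leq_mul (leqnn _) sq110) _.
rewrite mulnCA; apply: leq_trans (leq_mul (leqnn _) dou) _.
rewrite mulnACA -!expnD.
by rewrite (_ : 1320 + 30 = 1350)%N // (_ : 220 + 117 = 337)%N.
Qed.

Lemma fibers_lower_bound (R : realType) (I : finType) (t : nat) (m : I -> R)
    (a : I -> 'I_t -> R) (L : {fset R}) :
  (0 < #|I|)%N -> (0 < t)%N -> injective m -> (forall i, 0 <= m i) ->
  (forall i, injective (a i)) -> (forall i k, 0 < a i k) ->
  (forall i j k l, a i k * a j l * (1 + m i * m j) \in L) ->
  ((#|I| * t) ^ 225 <= 2 ^ 1350 * #|` L| ^ 337)%N.
Proof.
move=> I0 t0 minj m0 ainj a0 aL.
have /card_gt0P[i0 _] := I0.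
have tu := fiber_card_le t0 m0 ainj a0 aL i0.
have dir := directions_le t0 minj ainj a0 aL.
have dou := fibers_doubling t0 minj m0 ainj a0 aL I0.
move: #|I| #|` L| I0 tu dir dou => M u M0 tu dir dou.
have u0 : (0 < u)%N by apply: leq_trans tu.
(* With fewer than 16 slopes, M t <= 2^4 u already follows from t <= u. *)
have [M16|M16] := leqP 16 M; last first.
  by apply: (@leq_exp_of_linear 2) => //; apply: leq_mul => //; apply: ltnW.
have [un|un] := leqP (2 * u) (M * t).
  exact: (@leq_exp_of_doubling 2 M t u (dir M16 un) dou).
apply: (@leq_exp_of_linear 2) => //; apply: leq_trans (ltnW un) _; by rewrite leq_mul2r orbT.
Qed.

(** * Dyadic pigeonholing over slopes *)

Lemma dyadic_level (T : eqType) (s : seq T) (f : T -> nat) :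
  (0 < \sum_(x <- s) f x)%N -> exists2 t, (0 < t)%N &
    (\sum_(x <- s) f x <= 2 * (trunc_log 2 (\sum_(x <- s) f x)).+1 *
       (t * count (fun x => t <= f x) s))%N.
Proof.
set N := (\sum_(x <- s) f x)%N => N0; set J := (trunc_log 2 N).+1.
pose c j := count (fun x => 2 ^ j <= f x)%N s.
case: (pickP (fun j : 'I_J => N <= 2 * J * (2 ^ j * c j))%N) => [j jP|none].
  by exists (2 ^ j)%N; rewrite ?expn_gt0.
exfalso; have : (J * N < J * N)%N; last by rewrite ltnn.
(* Each positive f x is below 2^(j+1) for the largest j with 2^j <= f x, so the levels together
   dominate N and one of the J levels carries its share. *)
have bound : (N <= \sum_(j < J) 2 ^ j.+1 * c j)%N.
  have -> : (\sum_(j < J) 2 ^ j.+1 * c j =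
      \sum_(x <- s) \sum_(j < J) 2 ^ j.+1 * (2 ^ j <= f x))%N.
    rewrite exchange_big /=; apply: eq_bigr => j _.
    by rewrite -big_distrr /c -sum1_count big_mkcond.
  rewrite /N !big_seq; apply: leq_sum => x xs.
  case: (posnP (f x)) => [->//|fx0].
  have fN : (f x <= N)%N by rewrite /N (big_rem x) // leq_addr.
  have jJ : (trunc_log 2 (f x) < J)%N by rewrite ltnS leq_trunc_log.
  rewrite (bigD1 (Ordinal jJ)) //=.
  have /andP[h1 h2] := trunc_log_bounds (isT : 1 < 2)%N fx0.
  by rewrite h1 muln1 (leq_trans (ltnW h2)) // leq_addr.
have {}bound := leq_mul (leqnn J) bound.
apply: leq_ltn_trans bound _.
rewrite big_distrr /=.
apply: (@leq_ltn_trans (\sum_(j < J) N.-1)).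
  apply: leq_sum => j _; rewrite -ltnS prednK // ltnNge.
  by have := none j; rewrite expnS -mulnA mulnCA -mulnA => ->.
by rewrite sum_nat_const card_ord ltn_pmul2l // prednK.
Qed.

(** The pair (m, a) encodes the point a(1, m). The slopes with at least t points are kept, with
    exactly t points chosen on each. *)
Lemma slope_radius_lower_bound (R : realType) (Q : {fset R * R}) (L : {fset R}) :
  (0 < #|` Q|)%N -> (forall q, q \in Q -> 0 <= q.1 /\ 0 < q.2) ->
  (forall p q, p \in Q -> q \in Q -> p.2 * q.2 * (1 + p.1 * q.1) \in L) ->
  (#|` Q| ^ 225 <= (2 * (trunc_log 2 #|` Q|).+1) ^ 225 * (2 ^ 1350 * #|` L| ^ 337))%N.
Proof.
move=> Q0 Qpos QL.
pose S := [fset q.1 | q in Q]%fset.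
pose fiber x := [fset q in Q | q.1 == x]%fset.
have QE : (#|` Q| = \sum_(x <- S) #|` fiber x|)%N.
  rewrite (card_fset_sum1 Q) (partition_big_imfset _ (fun q : R * R => q.1)) /=.
  apply: eq_bigr => x _; rewrite (card_fset_sum1 (fiber x)).
  by rewrite big_fset.
have [t t0 tQ] : exists2 t, (0 < t)%N & (#|` Q| <= 2 * (trunc_log 2 #|` Q|).+1 *
    (t * count (fun x => t <= #|` fiber x|)%N S))%N.
  by rewrite QE; apply: dyadic_level; rewrite -QE.
pose X := [fset x in S | (t <= #|` fiber x|)%N]%fset.
have XE : count (fun x => t <= #|` fiber x|)%N S = #|{: X}|.
  rewrite -cardfE (card_fset_sum1 X) big_fset /= -sum1_count.
  by apply: eq_bigl.
have Xt (i : X) : (t <= #|` fiber (val i)|)%N.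
  by have := valP i; rewrite !inE => /andP[].
pose a (i : X) (k : 'I_t) := (nth (0, 0) (fiber (val i)) k).2.
have fibP (i : X) (k : 'I_t) : (val i, a i k) \in Q.
  have : nth (0, 0) (fiber (val i)) k \in fiber (val i).
    by apply: mem_nth; apply: leq_trans (Xt i).
  rewrite /a; case: (nth _ _ _) => x y; rewrite !inE /= => /andP[xyQ /eqP <-].
  exact: xyQ.
have X0 : (0 < #|{: X}|)%N.
  by rewrite lt0n -XE; apply: contraTneq tQ => ->; rewrite !muln0 -ltnNge.
have fst_nth (i : X) (k : 'I_t) : (nth (0, 0) (fiber (val i)) k).1 = val i.
  have : nth (0, 0) (fiber (val i)) k \in fiber (val i).
    by apply: mem_nth; apply: leq_trans (Xt i).
  by rewrite !inE /= => /andP[_ /eqP].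
have a_inj (i : X) : injective (a i).
  move=> k l akl; apply: ord_inj; apply/eqP.
  rewrite -(nth_uniq (0, 0) _ _ (fset_uniq (fiber (val i)))) ?(leq_trans _ (Xt i)) //.
  by apply/eqP/injective_projections; rewrite ?fst_nth.
have main := @fibers_lower_bound R X t val a L X0 t0 val_inj
  (fun i => (Qpos _ (fibP i (Ordinal t0))).1) a_inj
  (fun i k => (Qpos _ (fibP i k)).2)
  (fun i j k l => QL _ _ (fibP i k) (fibP j l)).
apply: (@leq_trans ((2 * (trunc_log 2 #|` Q|).+1 * (t * #|{: X}|)) ^ 225)).
  by rewrite leq_exp2r // -XE.
by rewrite expnMn leq_mul2l [(t * _)%N]mulnC main orbT.
Qed.

(** * Reduction to one quadrant and conclusion *)

Definition quarter_turn (R : realType) (k : 'I_4) (p : 'rV[R]_2) : R * R :=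
  nth (0, 0) [:: (p 0 0, p 0 1); (p 0 1, - p 0 0);
                 (- p 0 0, - p 0 1); (- p 0 1, p 0 0)] k.

Lemma dot_quarter_turn (R : realType) k (p q : 'rV[R]_2) :
  dot p q = (quarter_turn k p).1 * (quarter_turn k q).1
          + (quarter_turn k p).2 * (quarter_turn k q).2.
Proof.
by case: k => -[|[|[|[|//]]]] lt4; rewrite /quarter_turn /dot /=; ring.
Qed.

Lemma quarter_turn_inj (R : realType) k : injective (@quarter_turn R k).
Proof.
move=> p q E; suff [e0 e1] : p 0 0 = q 0 0 /\ p 0 1 = q 0 1.
  apply/matrixP => i j; rewrite ord1; case: j => -[|[|//]] lt2.
    by rewrite (_ : Ordinal lt2 = 0) //; apply: val_inj.
  by rewrite (_ : Ordinal lt2 = 1) //; apply: val_inj.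
by case: k E => -[|[|[|[|//]]]] lt4; rewrite /quarter_turn /= => -[];
  try move=> /oppr_inj; move=> ->; try move=> /oppr_inj; move=> ->.
Qed.

Lemma quarter_turn_quadrant (R : realType) (p : 'rV[R]_2) : p != 0 ->
  exists k, 0 < (quarter_turn k p).1 /\ 0 <= (quarter_turn k p).2.
Proof.
move=> p0; case: (ltrgtP (p 0 0) 0) => x0; case: (ltrgtP (p 0 1) 0) => y0.
- exists (inord 2); rewrite /quarter_turn inordK //=; split; lra.
- exists (inord 1); rewrite /quarter_turn inordK //=; split; lra.
- exists (inord 2); rewrite /quarter_turn inordK //=; split; lra.
- exists (inord 3); rewrite /quarter_turn inordK //=; split; lra.
- exists (inord 0); rewrite /quarter_turn inordK //=; split; lra.
- exists (inord 0); rewrite /quarter_turn inordK //=; split; lra.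
- exists (inord 3); rewrite /quarter_turn inordK //=; split; lra.
- exists (inord 1); rewrite /quarter_turn inordK //=; split; lra.
exfalso; case/eqP: p0; apply/matrixP => i j; rewrite ord1 mxE; case: j => -[|[|//]] lt2.
  by rewrite (_ : Ordinal lt2 = 0) //; apply: val_inj.
by rewrite (_ : Ordinal lt2 = 1) //; apply: val_inj.
Qed.

(** The powers of b add up to 3 * 225 + 225 + 1350 = 2250, which is below 7 * 337 = 2359. *)
Lemma leq_exp_of_slopes (b N q J J' u : nat) : (0 < b)%N -> (0 < J)%N -> (J' <= J)%N ->
  (N <= b ^ 3 * q)%N ->
  (q ^ 225 <= (b * J') ^ 225 * (b ^ 1350 * u ^ 337))%N ->
  (N ^ 225 <= (b ^ 7 * J * u) ^ 337)%N.
Proof.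
move=> b0 J0 JJ Nq h; apply: (@leq_trans ((b ^ 3 * q) ^ 225)); first by rewrite leq_exp2r.
rewrite expnMn; apply: leq_trans (leq_mul (leqnn _) h) _.
have -> : ((b ^ 7 * J * u) ^ 337 = b ^ (7 * 337) * J ^ 337 * u ^ 337)%N.
  by rewrite expnMn expnMn -expnM.
have reorder x y w v z : (x * (y * w * (v * z)) = x * y * v * w * z)%N by lia.
rewrite -expnM (expnMn b J') reorder -!expnD.
apply: leq_mul (leqnn _); apply: leq_mul; first by rewrite leq_pexp2l.
by apply: (leq_trans (n := (J ^ 225)%N)); [rewrite leq_exp2r|rewrite leq_pexp2l].
Qed.

Lemma dot_products_lower_bound (R : realType) (P : {fset 'rV[R]_2}) : (2 <= #|` P|)%N ->
  (#|` P| ^ 225 <= (2 ^ 7 * (trunc_log 2 #|` P|).+1 * #|` Lambda P|) ^ 337)%N.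
Proof.
move=> P2; set N := #|` P|; set J := (trunc_log 2 N).+1; set u := #|` Lambda P|.
pose D k := [fset p in P | (0 < (quarter_turn k p).1) && (0 <= (quarter_turn k p).2)]%fset.
(* The four half-open quadrants cover all of [P] except possibly the origin, and N - 1 >= N / 2. *)
have [k kP] : exists k, (N <= 8 * #|` D k|)%N.
  case: (pickP (fun k => N <= 8 * #|` D k|)%N) => [k ?|none]; first by exists k.
  have : (N <= 1 + \sum_k #|` D k|)%N.
    have z1 : (\sum_(p <- P) (p == 0%R) <= 1)%N.
      by rewrite -big_mkcond /= sum1_count count_uniq_mem ?fset_uniq // leq_b1.
    apply: leq_trans (leq_add z1 (leqnn _)).
    have -> : (\sum_k #|` D k| = \sum_(p <- P) \sum_k
        ((0 < (quarter_turn k p).1) && (0 <= (quarter_turn k p).2))%R)%N.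
      rewrite exchange_big /=; apply: eq_bigr => k _.
      by rewrite (card_fset_sum1 (D k)) big_fset /= big_mkcond.
    rewrite -big_split /= /N (card_fset_sum1 P); apply: leq_sum => p _.
    case: eqVneq => //= p0; have [k [k1 k2]] := quarter_turn_quadrant p0.
    by rewrite (bigD1 k) //= k1 k2.
  have : (\sum_(k < 4) 8 * #|` D k| <= \sum_(k < 4) N.-1)%N.
    by apply: leq_sum => k _; have := none k; lia.
  rewrite -big_distrr /= sum_nat_const card_ord; lia.
pose f (p : 'rV[R]_2) := ((quarter_turn k p).2 / (quarter_turn k p).1, (quarter_turn k p).1).
pose Q := [fset f p | p in D k]%fset.
have Qc : #|` Q| = #|` D k|.
  apply: card_in_imfset => p q /=; rewrite !inE /= => /andP[_ /andP[p0 _]] /andP[_ /andP[q0 _]].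
  rewrite /f => -[E1 E2]; apply: (@quarter_turn_inj _ k).
  rewrite [LHS]surjective_pairing [RHS]surjective_pairing; congr (_, _) => //.
  by move: E1; rewrite E2 => /(mulIf (invr_neq0 (lt0r_neq0 q0))).
have Q0 : (0 < #|` Q|)%N by rewrite Qc; lia.
have Qpos q : q \in Q -> 0 <= q.1 /\ 0 < q.2.
  move=> /imfsetP[p /= pD ->]; move: pD; rewrite !inE /= => /andP[_ /andP[p1 p2]].
  by split=> //; rewrite divr_ge0 // ltW.
have QL p' q' : p' \in Q -> q' \in Q -> p'.2 * q'.2 * (1 + p'.1 * q'.1) \in Lambda P.
  move=> /imfsetP[p /= pD ->] /imfsetP[q /= qD ->]; move: pD qD; rewrite !inE /=.
  move=> /andP[pP /andP[p1 p2]] /andP[qP /andP[q1 q2]].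
  suff -> : (quarter_turn k p).1 * (quarter_turn k q).1 *
     (1 + (quarter_turn k p).2 / (quarter_turn k p).1 *
        ((quarter_turn k q).2 / (quarter_turn k q).1)) = dot p q.
    by apply/imfset2P; exists p => //; exists q.
  by rewrite (dot_quarter_turn k); field; rewrite !lt0r_neq0.
have main := slope_radius_lower_bound Q0 Qpos QL.
apply: (@leq_exp_of_slopes 2 N #|` Q| J (trunc_log 2 #|` Q|).+1 u) main => //.
  rewrite ltnS leq_trunc_log // Qc fsubset_leq_card //.
  by apply/fsubsetP => p; rewrite inE => /andP[].
by rewrite Qc.
Qed.

Theorem theorem1p1 (R : realType) :
  gtrsim (fun P : {fset 'rV[R]_2} => (2 <= #|` P|)%N)
         (fun P : {fset 'rV[R]_2} => (#|` Lambda P|)%:R : R)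
         (fun P : {fset 'rV[R]_2} =>
            (#|` P|)%:R `^ (2%:R / 3%:R + 1 / 3057%:R) : R).
Proof.
(* 384 = 3 * 2^7: the factor 2^7 comes from the bound in natural numbers, and 3 from J <= 3 log2
   (N^b). *)
exists (384%:R^-1), 1; split; first by rewrite invr_gt0 ltr0n.
split=> // P P2; set b := _ + _ / _.
have := dot_products_lower_bound P2.
set N := #|` P| in P2 *; set u := #|` Lambda P|; set J := (trunc_log 2 N).+1 => main.
have ln2 : 0 < ln 2 :> R by rewrite ln_gt0 // ltr1n.
have N0 : 0 < N%:R :> R by rewrite ltr0n (leq_trans _ P2).
have N2 : 2 <= N%:R :> R by rewrite (ler_nat R 2).
have lnN : ln 2 <= ln N%:R :> R by rewrite ler_ln ?posrE.
have tlN : (trunc_log 2 N)%:R * ln 2 <= ln N%:R :> R.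
  have tl : (2 ^ trunc_log 2 N)%:R <= N%:R :> R.
    by rewrite ler_nat trunc_logP // (leq_trans _ P2).
  by rewrite mulr_natl -lnXn // ler_ln ?posrE ?exprn_gt0 // -natrX.
have b23 : 2 <= b * 3 by rewrite /b; lra.
(* J is at most 2 log2 N because N >= 2, and 2 <= 3 b. *)
have JY : J%:R <= 3 * log2 (N%:R `^ b).
  rewrite /log2 ln_powR mulrA ler_pdivlMr // /J -natr1 mulrDl mul1r mulrA [3 * b]mulrC.
  apply: (@le_trans _ _ (2 * ln N%:R)); first lra.
  by rewrite ler_wpM2r // (le_trans (ltW ln2)).
have Y0 : 0 <= log2 (N%:R `^ b).
  by rewrite -(pmulr_rge0 _ (ltr0n _ 3)) (le_trans _ JY).
have YJ : N%:R `^ b <= 2 ^+ 7 * J%:R * u%:R.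
  rewrite -(@ler_pXn2r _ 337) ?nnegrE ?powR_ge0 ?mulr_ge0 //.
  rewrite -powR_mulrn ?powR_ge0 // -powRrM.
  (* Here 337 b <= 225, that is, b is at most 225/337. *)
  apply: (@le_trans _ _ (N%:R `^ 225%:R)).
    by apply: ler_powR; [rewrite ler1n (leq_trans _ P2)|rewrite /b; lra].
  rewrite powR_mulrn; last exact: ltW.
  by move: main; rewrite -(ler_nat R) !natrX natrM natrM natrX.
rewrite powRr1 // ler_pdivrMr; last first.
  by rewrite -(pmulr_rgt0 _ (ltr0n _ 3)) (lt_le_trans _ JY) // ltr0n.
rewrite mulrC ler_pdivrMr ?ltr0n //; apply: le_trans YJ _.
have -> : u%:R * log2 (N%:R `^ b) * 384%:R = 2 ^+ 7 * (3 * log2 (N%:R `^ b)) * u%:R by ring.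
by rewrite ler_wpM2r // ler_wpM2l // exprn_ge0.
Qed.
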